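(* Let $N\ge3$, $p>p_S$ and $n\ge1$. Then $\lambda_n(\gamma)\to\lambda_n^*$ as $\gamma\to\infty$, where $\lambda_n^*:=(s_n^* )^2$ and $s_n^*$ is the $n$-th positive critical point of $u^*$.
   Context: $f(U):=-U+U^p$, $p_S:=\frac{N+2}{N-2}$, $\theta:=\frac{2}{p-1}$, $A:=\{\theta(N-2-\theta)\}^{1/(p-1)}$, $m:=\{\theta(N-2-\theta)\}^{-1/2}$, $\alpha:=m(N-2-2\theta)$. $u^*(s):=As^{-\theta}y^*(m^{-1}\log s)$ where $y^*$ is the unique solution on $\mathbb{R}$ of $y''+\alpha y'-y+y^p-m^2e^{2mt}y=0$ with $y(t)\to1$ as $t\to-\infty$; $u^*$ has infinitely many positive critical points $s_1^*<s_2^*<\cdots$. Problem (N): $U''+\frac{N-1}{r}U'+\lambda f(U)=0$ on $(0,1)$, $U'(0)=U'(1)=0$, $U>0$. For $\gamma>1$, $(\lambda_n(\gamma),U_n(\cdot,\gamma))$ denotes the solution on the branch $\mathcal C_n$ (closure of the curve of nonconstant solutions of (N) bifurcating from $(\mu_n/(p-1),1)$, $\mu_n$ the $n$-th nonzero radial Neumann eigenvalue of $-\Delta$ on the unit ball) with $U_n(0,\gamma)=\gamma$; equivalently $\sqrt{\lambda_n(\gamma)}$ is the $n$-th positive critical point of the solution $u(s,\gamma)$ of $u''+\frac{N-1}{s}u'+f(u)=0$, $u(0)=\gamma$, $u'(0)=0$. *)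

(* Defs.v *)
From Stdlib Require Import Reals Lra Lia.
Open Scope R_scope.

Definition pS (N : nat) : R := (INR N + 2) / (INR N - 2).
Definition theta (p : R) : R := 2 / (p - 1).
Definition Aconst (N : nat) (p : R) : R :=
  Rpower (theta p * (INR N - 2 - theta p)) (1 / (p - 1)).
Definition mconst (N : nat) (p : R) : R :=
  / sqrt (theta p * (INR N - 2 - theta p)).
Definition alpha (N : nat) (p : R) : R :=
  mconst N p * (INR N - 2 - 2 * theta p).

(* x^p for x > 0, extended by 0 for x <= 0 (only positive values matter). *)
Definition ppow (p x : R) : R := if Rlt_dec 0 x then Rpower x p else 0.

Definition fN (p x : R) : R := - x + ppow p x.

Definition is_ystar (N : nat) (p : R) (y : R -> R) : Prop :=
  (exists dy ddy : R -> R, forall t : R,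
      derivable_pt_lim y t (dy t) /\ derivable_pt_lim dy t (ddy t) /\
      ddy t + alpha N p * dy t - y t + ppow p (y t)
        - (mconst N p) ^ 2 * exp (2 * mconst N p * t) * y t = 0) /\
  (forall eps : R, 0 < eps -> exists T : R, forall t : R, t < T -> Rabs (y t - 1) < eps).

(* u^*(s) = A s^{-theta} y^*(m^{-1} log s)   (relevant for s > 0) *)
Definition ustar (N : nat) (p : R) (y : R -> R) (s : R) : R :=
  Aconst N p * Rpower s (- theta p) * y (ln s / mconst N p).

Definition is_nth_crit (g : R -> R) (n : nat) (s : R) : Prop :=
  exists c : nat -> R,
    c n = s /\
    (forall k : nat, (1 <= k <= n)%nat -> 0 < c k /\ derivable_pt_lim g (c k) 0) /\
    (forall k : nat, (1 <= k < n)%nat -> c k < c (S k)) /\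
    (forall t : R, 0 < t < s -> derivable_pt_lim g t 0 ->
        exists k : nat, (1 <= k <= n)%nat /\ t = c k).

Definition is_radial_sol (N : nat) (p gamma : R) (g : R -> R) : Prop :=
  g 0 = gamma /\ derivable_pt_lim g 0 0 /\
  exists dg ddg : R -> R, forall s : R, 0 < s ->
    derivable_pt_lim g s (dg s) /\ derivable_pt_lim dg s (ddg s) /\
    ddg s + (INR N - 1) / s * dg s + fN p (g s) = 0.

(* Main.v *)
(** In the Emden-Fowler variables [y(t) = A^-1 s^theta u(s)], [s = exp (m t)], the radial equation becomes
    [y'' + a y' - y + y^p - m^2 exp(2 m t) y = 0] with [a > 0] (this is [p > p_S]), and the energy
    [y'^2/2 - y^2/2 + y^(p+1)/(p+1) - m^2 exp(2 m t) y^2/2] decreases. A regular solution leaves [y = 0]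
    at a time that tends to [-oo] with [gamma], loses a definite amount of energy, and is then trapped near
    the equilibrium [(1, 0)] after a bounded time. Near [(1, 0)] the equation is a damped oscillator, so the
    difference with [y*] decays exponentially; as the time available tends to infinity with [gamma],
    [y_gamma -> y*] first near [-oo] and then, by Gronwall, in C^1 on every interval [[T0, T2]].
    Critical points of [u] are the zeros of [y' - m theta y]; those of [u*] are nondegenerate, because a
    degenerate one would force [u*] to be constant, and so they persist in order. *)

Require Import Defs.
From Stdlib Require Import Reals Lra Lia.
From Coquelicot Require Import Coquelicot.
Open Scope R_scope.

(** * Calculus and the nonlinearity *)

(** As [t -> -oo] a regular orbit tends to [(0, 0)] and the singular one to [(1, 0)], so they cannot
    be compared uniformly on a half-line; moreover the forcing term keeps [(1, 0)] from being a
    solution. Hence two solutions are compared directly with each other, starting only once both are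
    close to [(1, 0)]. Radius, rate and waiting time must not depend on [gamma], which is why the
    quantitative lemmas produce their constants before the solutions are introduced. The dependence
    on [gamma] is scaled out by the time shift [ln gamma / c] with [c = m theta], the unstable
    exponent of the saddle [(0, 0)], where [c ^ 2 + a * c = 1]. The other obstacle is the counting:
    convergence on compact intervals says nothing about extra critical points far to the left, which
    would shift the index [n]. They are excluded by sign: as long as [u > 1], the flux [s^(N-1) u']
    decreases from [0], so [u' < 0]. *)

Lemma mvt (f df : R -> R) (a b : R) :
  a < b -> (forall x, a <= x <= b -> is_derive f x (df x)) ->
  exists c, f b - f a = df c * (b - a) /\ a < c < b.
Proof.
  intros Hab Hd; apply MVT_cor2; [ exact Hab | ].
  intros c Hc; apply is_derive_Reals; auto.
Qed.

Lemma antitone (f df : R -> R) (a b : R) :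
  a <= b -> (forall x, a <= x <= b -> is_derive f x (df x)) ->
  (forall x, a <= x <= b -> df x <= 0) -> f b <= f a.
Proof.
  intros Hab Hd Hs; destruct (Rle_lt_or_eq_dec _ _ Hab) as [H| ->]; [ | lra ].
  destruct (mvt f df a b H Hd) as (c & Hc & Hc'). specialize (Hs c ltac:(lra)). nra.
Qed.

Lemma strictly_antitone (f df : R -> R) (a b : R) :
  a < b -> (forall x, a <= x <= b -> is_derive f x (df x)) ->
  (forall x, a <= x <= b -> df x < 0) -> f b < f a.
Proof.
  intros H Hd Hs.
  destruct (mvt f df a b H Hd) as (c & Hc & Hc'). specialize (Hs c ltac:(lra)). nra.
Qed.

(** The product of [V] with [exp (- K x)] is nonincreasing. [K] may have either sign: positive
    values bound growth, negative ones give the decay of the damped oscillator. *)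
Lemma gronwall (V dV : R -> R) (K a b : R) :
  a <= b -> (forall x, a <= x <= b -> is_derive V x (dV x)) ->
  (forall x, a <= x <= b -> dV x <= K * V x) -> V b <= exp (K * (b - a)) * V a.
Proof.
  intros Hab Hd Hs.
  assert (H : exp (- K * b) * V b <= exp (- K * a) * V a).
  { apply (antitone (fun x => exp (- K * x) * V x)
      (fun x => exp (- K * x) * (dV x - K * V x))); [ exact Hab | | ].
    - intros x Hx. auto_derive.
      + exists (dV x); auto.
      + rewrite (is_derive_unique (fun x : R => V x) x _ (Hd x Hx)). ring.
    - intros x Hx. specialize (Hs x Hx). pose proof (exp_pos (- K * x)). nra. }
  replace (K * (b - a)) with (K * b + - K * a) by ring. rewrite exp_plus.
  apply (Rmult_le_compat_l (exp (K * b))) in H; [ | left; apply exp_pos ].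
  rewrite <- 2!Rmult_assoc, <- exp_plus in H.
  replace (K * b + - K * b) with 0 in H by ring. rewrite exp_0 in H. lra.
Qed.

Lemma gronwall_backward (V dV : R -> R) (K a b : R) :
  a <= b -> (forall x, a <= x <= b -> is_derive V x (dV x)) ->
  (forall x, a <= x <= b -> - K * V x <= dV x) -> V a <= exp (K * (b - a)) * V b.
Proof.
  intros Hab Hd Hs.
  pose proof (gronwall (fun x => V (- x)) (fun x => - dV (- x)) K (- b) (- a)) as H.
  simpl in H. rewrite 2!Ropp_involutive in H.
  replace (K * (b - a)) with (K * (- a - - b)) by ring. apply H; [ lra | | ].
  - intros x Hx. auto_derive.
    + exists (dV (- x)); apply Hd; lra.
    + rewrite (is_derive_unique (fun z : R => V z) (- x) _ (Hd (- x) ltac:(lra))). ring.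
  - intros x Hx. specialize (Hs (- x) ltac:(lra)). lra.
Qed.

(** The data of a regular solution sit at [s = 0], that is at [t = -oo]; this is how a monotonicity
    estimate starts from them. *)
Lemma antitone_le_lim (f df : R -> R) (T l : R) :
  (forall x, x <= T -> is_derive f x (df x)) -> (forall x, x <= T -> df x <= 0) ->
  is_lim f m_infty l -> f T <= l.
Proof.
  intros Hd Hs Hl.
  apply (is_lim_le_loc (fun _ => f T) f m_infty (f T) l); [ | apply is_lim_const | exact Hl ].
  exists T. intros x Hx. apply (antitone f df); [ lra | | ]; intros; [ apply Hd | apply Hs ]; lra.
Qed.

Lemma is_lim_mult' (f g : R -> R) (x : Rbar) (lf lg : R) :
  is_lim f x lf -> is_lim g x lg -> is_lim (fun t => f t * g t) x (lf * lg).
Proof.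
  intros Hf Hg. apply (is_lim_mult f g x lf lg Hf Hg). exact I.
Qed.

Lemma is_lim_exp_scal (c : R) : 0 < c -> is_lim (fun t => exp (c * t)) m_infty 0.
Proof.
  intros Hc. apply (is_lim_comp exp (fun t => c * t) m_infty 0 m_infty).
  - exact is_lim_exp_m.
  - replace m_infty with (Rbar_mult c m_infty) at 2.
    + apply is_lim_scal_l, is_lim_id.
    + simpl. case Rle_dec; intros; [ | lra ]. case Rle_lt_or_eq_dec; intros; [ reflexivity | lra ].
  - exists 0; discriminate.
Qed.

Lemma is_lim_minf_eventually (f : R -> R) (l eps : R) :
  is_lim f m_infty l -> 0 < eps -> exists T, forall t, t < T -> Rabs (f t - l) < eps.
Proof.
  intros H He. apply is_lim_spec in H. exact (H (mkposreal eps He)).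
Qed.

Lemma exp_le_of (x y : R) : x <= y -> exp x <= exp y.
Proof.
  intros [H| ->]; [ left; apply exp_increasing; exact H | right; reflexivity ].
Qed.

Lemma exp_eventually_le (c e : R) : 0 < c -> 0 < e -> exists T, forall t, t <= T -> exp (c * t) <= e.
Proof.
  intros Hc He. exists (ln e / c). intros t Ht. rewrite <- (exp_ln e He) at 1. apply exp_le_of.
  apply (Rmult_le_compat_l c) in Ht; [ | lra ]. replace (c * (ln e / c)) with (ln e) in Ht by (field; lra).
  exact Ht.
Qed.

Lemma Rabs_le_of_sq (x b : R) : 0 <= b -> x ^ 2 <= b ^ 2 -> Rabs x <= b.
Proof.
  intros Hb H. rewrite <- (Rabs_pos_eq b) by exact Hb. apply Rsqr_le_abs_0. unfold Rsqr. lra.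
Qed.

(** * The power function extended by zero *)

Lemma ppow_pos (p x : R) : 0 < x -> ppow p x = Rpower x p.
Proof. intros H; unfold ppow; destruct (Rlt_dec 0 x); [ reflexivity | lra ]. Qed.

Lemma ppow_nonpos (p x : R) : x <= 0 -> ppow p x = 0.
Proof. intros H; unfold ppow; destruct (Rlt_dec 0 x); [ lra | reflexivity ]. Qed.

Lemma ppow_ge0 (p x : R) : 0 <= ppow p x.
Proof.
  unfold ppow; destruct (Rlt_dec 0 x); [ left; apply exp_pos | lra ].
Qed.

Lemma ppow_gt0 (p x : R) : 0 < x -> 0 < ppow p x.
Proof. intros H; rewrite ppow_pos by exact H. apply exp_pos. Qed.

Lemma ppow_1 (p : R) : ppow p 1 = 1.
Proof. rewrite ppow_pos by lra. unfold Rpower. rewrite ln_1, Rmult_0_r. apply exp_0. Qed.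

Lemma ppow_pred (p x : R) : x * ppow (p - 1) x = ppow p x.
Proof.
  destruct (Rlt_dec 0 x) as [H|H].
  - rewrite 2!ppow_pos by exact H. rewrite <- (Rpower_1 x) at 1 by exact H.
    rewrite <- Rpower_plus. f_equal; ring.
  - rewrite 2!ppow_nonpos by lra. ring.
Qed.

Lemma ppow_le (q x y : R) : 0 <= q -> x <= y -> ppow q x <= ppow q y.
Proof.
  intros Hq Hxy. destruct (Rlt_dec 0 x) as [H|H].
  - rewrite 2!ppow_pos by lra. apply Rle_Rpower_l; lra.
  - rewrite (ppow_nonpos q x) by lra. apply ppow_ge0.
Qed.

Lemma ppow_lt (q x y : R) : 0 < q -> 0 < x -> x < y -> ppow q x < ppow q y.
Proof.
  intros Hq H Hxy. rewrite 2!ppow_pos by lra. apply exp_increasing.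
  apply Rmult_lt_compat_l; [ lra | ]. apply ln_increasing; lra.
Qed.

Lemma ppow_continuous (q x : R) : 0 < q -> continuous (ppow q) x.
Proof.
  intros Hq. destruct (Rtotal_order x 0) as [H|[H|H]].
  - apply (continuous_ext_loc _ (fun _ => 0)); [ | apply continuous_const ].
    exists (mkposreal (- x) ltac:(lra)). intros y Hy.
    apply Rabs_lt_between' in Hy; simpl in Hy. rewrite ppow_nonpos; lra.
  - subst x. apply continuity_pt_filterlim. intros eps He.
    exists (Rpower eps (/ q)). split; [ apply exp_pos | ].
    intros y [_ Hy]. simpl in *. unfold Rdist in *. rewrite Rminus_0_r in Hy.
    rewrite (ppow_nonpos q 0), Rminus_0_r by lra. rewrite Rabs_pos_eq by apply ppow_ge0.
    destruct (Rlt_dec 0 y) as [Hp|Hp]; [ | rewrite ppow_nonpos; lra ].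
    rewrite Rabs_pos_eq in Hy by lra.
    apply (ppow_lt q) in Hy; [ | exact Hq | exact Hp ].
    rewrite (ppow_pos q (Rpower _ _)) in Hy by apply exp_pos.
    rewrite Rpower_mult, Rinv_l, Rpower_1 in Hy; lra.
  - apply (continuous_ext_loc _ (fun y => Rpower y q)).
    + exists (mkposreal x H). intros y Hy. apply Rabs_lt_between' in Hy; simpl in Hy.
      rewrite ppow_pos; lra.
    + unfold Rpower. apply continuous_exp_comp. apply (continuous_mult (fun _ => q) ln).
      * apply continuous_const.
      * apply continuity_pt_filterlim. apply derivable_continuous_pt. exists (/ x).
        apply derivable_pt_lim_ln; exact H.
Qed.

(** At [0] the difference quotient is [h^(p-1)], which tends to [0] because [p > 1]. The extension
    is therefore C^1 on the whole line, and solutions can be handled before their sign is known. *)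
Lemma ppow_is_derive (p x : R) : 1 < p -> is_derive (ppow p) x (p * ppow (p - 1) x).
Proof.
  intros Hp. destruct (Rtotal_order x 0) as [H|[H|H]].
  - rewrite ppow_nonpos, Rmult_0_r by lra.
    apply (is_derive_ext_loc (fun _ => 0)); [ | apply @is_derive_const ].
    exists (mkposreal (- x) ltac:(lra)). intros y Hy.
    apply Rabs_lt_between' in Hy; simpl in Hy. rewrite ppow_nonpos; lra.
  - subst x. rewrite (ppow_nonpos (p - 1)), Rmult_0_r by lra. apply is_derive_Reals.
    intros eps He.
    assert (Hc := ppow_continuous (p - 1) 0 ltac:(lra)).
    apply continuity_pt_filterlim in Hc. destruct (Hc eps He) as (d & Hd & Hc').
    exists (mkposreal d Hd). intros h Hh0 Hh. simpl in Hh.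
    rewrite Rplus_0_l, (ppow_nonpos p 0), 2!Rminus_0_r by lra.
    rewrite <- ppow_pred. replace (h * ppow (p - 1) h / h) with (ppow (p - 1) h) by (field; exact Hh0).
    specialize (Hc' h). simpl in Hc'. unfold Rdist in Hc'.
    rewrite (ppow_nonpos _ 0), 2!Rminus_0_r in Hc' by lra. apply Hc'.
    split; [ split; [ exact I | congruence ] | exact Hh ].
  - apply (is_derive_ext_loc (fun y => Rpower y p)).
    + exists (mkposreal x H). intros y Hy. apply Rabs_lt_between' in Hy; simpl in Hy.
      rewrite ppow_pos; lra.
    + rewrite ppow_pos by exact H. apply is_derive_Reals, derivable_pt_lim_power, H.
Qed.

Lemma ppow_lipschitz (p M x y : R) : 1 < p -> Rabs x <= M -> Rabs y <= M ->
  Rabs (ppow p x - ppow p y) <= p * ppow (p - 1) M * Rabs (x - y).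
Proof.
  intros Hp Hx Hy.
  destruct (MVT_gen (ppow p) y x (fun z => p * ppow (p - 1) z)) as (c & Hc & ->).
  - intros; apply ppow_is_derive, Hp.
  - intros z _. apply continuity_pt_filterlim, ppow_continuous; lra.
  - rewrite Rabs_mult. apply Rmult_le_compat_r; [ apply Rabs_pos | ].
    rewrite Rabs_pos_eq; [ | pose proof (ppow_ge0 (p - 1) c); nra ].
    apply Rmult_le_compat_l; [ lra | ]. apply ppow_le; [ lra | ].
    apply Rle_trans with (Rmax y x); [ apply Hc | ].
    apply Rmax_lub; [ apply Rle_trans with (2 := Hy) | apply Rle_trans with (2 := Hx) ]; apply Rle_abs.
Qed.

(** Both points vary, instead of one being fixed at [1], because the estimate is applied to the
    difference of two solutions. *)
Lemma ppow_linearization_at_1 (p eps : R) : 1 < p -> 0 < eps -> exists rho, 0 < rho /\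
  forall x y, Rabs (x - 1) <= rho -> Rabs (y - 1) <= rho ->
    Rabs (ppow p x - ppow p y - p * (x - y)) <= eps * Rabs (x - y).
Proof.
  intros Hp He.
  assert (Hc := ppow_continuous (p - 1) 1 ltac:(lra)).
  apply continuity_pt_filterlim in Hc.
  destruct (Hc (eps / p) ltac:(apply Rdiv_lt_0_compat; lra)) as (d & Hd & Hc').
  exists (d / 2). split; [ lra | ]. intros x y Hx Hy.
  destruct (MVT_gen (ppow p) y x (fun z => p * ppow (p - 1) z)) as (c & Hcc & ->).
  - intros; apply ppow_is_derive, Hp.
  - intros z _. apply continuity_pt_filterlim, ppow_continuous; lra.
  - replace (p * ppow (p - 1) c * (x - y) - p * (x - y))
      with (p * (ppow (p - 1) c - 1) * (x - y)) by ring.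
    rewrite Rabs_mult. apply Rmult_le_compat_r; [ apply Rabs_pos | ].
    rewrite Rabs_mult, (Rabs_pos_eq p) by lra.
    replace eps with (p * (eps / p)) by (field; lra).
    apply Rmult_le_compat_l; [ lra | ].
    destruct (Req_dec c 1) as [->|Hn].
    { rewrite ppow_1, Rminus_diag, Rabs_R0. left; apply Rdiv_lt_0_compat; lra. }
    specialize (Hc' c). simpl in Hc'. unfold Rdist in Hc'. rewrite ppow_1 in Hc'.
    left; apply Hc'. split; [ split; [ exact I | congruence ] | ].
    apply Rabs_le_between' in Hx. apply Rabs_le_between' in Hy.
    apply Rabs_lt_between'. revert Hcc. unfold Rmin, Rmax. destruct (Rle_dec y x); lra.
Qed.

Lemma primitive_is_derive (p x : R) : 1 < p ->
  is_derive (fun z => z * ppow p z / (p + 1)) x (ppow p x).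
Proof.
  intros Hp. auto_derive.
  - exists (p * ppow (p - 1) x). apply ppow_is_derive, Hp.
  - rewrite (is_derive_unique (fun z : R => ppow p z) _ _ (ppow_is_derive p x Hp)).
    rewrite <- (ppow_pred p x). field. lra.
Qed.

(** * The Emden-Fowler equation *)

Definition emden (a m p : R) (y dy : R -> R) : Prop :=
  forall t, is_derive y t (dy t) /\
    is_derive dy t (- a * dy t + y t - ppow p (y t) + m ^ 2 * exp (2 * m * t) * y t).

Definition energy (m p : R) (y dy : R -> R) (t : R) : R :=
  dy t ^ 2 / 2 - y t ^ 2 / 2 + y t * ppow p (y t) / (p + 1)
  - m ^ 2 * exp (2 * m * t) * y t ^ 2 / 2.

(** Multiplying the equation by [y'] leaves only the damping and the time derivative of the forcing
    coefficient; for positive [a] and [m] both lower the energy. *)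
Lemma energy_is_derive (a m p : R) (y dy : R -> R) (t : R) : 1 < p -> emden a m p y dy ->
  is_derive (energy m p y dy) t (- a * dy t ^ 2 - m ^ 3 * exp (2 * m * t) * y t ^ 2).
Proof.
  intros Hp Hy. destruct (Hy t) as [H1 H2]. unfold energy. auto_derive.
  - repeat split; try (eexists; eassumption). eexists; apply ppow_is_derive, Hp.
  - rewrite (is_derive_unique (fun z : R => y z) _ _ H1).
    rewrite (is_derive_unique (fun z : R => dy z) _ _ H2).
    rewrite (is_derive_unique (fun z : R => ppow p z) _ _ (ppow_is_derive p (y t) Hp)).
    rewrite <- (ppow_pred p (y t)). field. lra.
Qed.

Lemma energy_antitone (a m p : R) (y dy : R -> R) (s t : R) :
  1 < p -> 0 < a -> 0 < m -> emden a m p y dy -> s <= t ->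
  energy m p y dy t <= energy m p y dy s.
Proof.
  intros Hp Ha Hm Hy Hst.
  apply (antitone _ (fun t => - a * dy t ^ 2 - m ^ 3 * exp (2 * m * t) * y t ^ 2)); [ exact Hst | | ].
  - intros; apply (energy_is_derive a); assumption.
  - intros x _. pose proof (exp_pos (2 * m * x)). pose proof (pow2_ge_0 (dy x)).
    pose proof (pow2_ge_0 (y x)). pose proof (pow_lt m 3 Hm).
    assert (0 <= m ^ 3 * exp (2 * m * x) * y x ^ 2) by (apply Rmult_le_pos; [ left; apply Rmult_lt_0_compat | ]; lra). nra.
Qed.

Definition sqdist (y dy z dz : R -> R) (t : R) : R := (y t - z t) ^ 2 + (dy t - dz t) ^ 2.

(** [K] depends on the parameters and on the bounds [M] and [b], not on the two solutions. The
    estimate is two-sided so that it serves Gronwall forwards (convergence) and backwards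
    (uniqueness). *)
Lemma sqdist_derivative_bound (a m p M b : R) : 1 < p -> 0 < a -> 0 < m ->
  exists K, 0 < K /\ forall y dy z dz, emden a m p y dy -> emden a m p z dz ->
  exists dV : R -> R,
    (forall t, is_derive (sqdist y dy z dz) t (dV t)) /\
    (forall t, t <= b -> Rabs (y t) <= M -> Rabs (z t) <= M ->
      Rabs (dV t) <= K * sqdist y dy z dz t).
Proof.
  intros Hp Ha Hm.
  set (L := p * ppow (p - 1) M). set (E := m ^ 2 * exp (2 * m * b)).
  assert (HL : 0 <= L) by (unfold L; pose proof (ppow_ge0 (p - 1) M); nra).
  assert (HE : 0 <= E) by (apply Rmult_le_pos; [ apply pow2_ge_0 | left; apply exp_pos ]).
  exists (2 + L + E + 2 * a). split; [ lra | ]. intros y dy z dz Hy Hz.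
  exists (fun t => 2 * (y t - z t) * (dy t - dz t) + 2 * (dy t - dz t) *
    (- a * (dy t - dz t) + (y t - z t) - (ppow p (y t) - ppow p (z t))
       + m ^ 2 * exp (2 * m * t) * (y t - z t))).
  split.
  - intros t. destruct (Hy t) as [H1 H2]. destruct (Hz t) as [H3 H4]. unfold sqdist. auto_derive.
    + repeat split; eexists; eassumption.
    + rewrite (is_derive_unique (fun x : R => y x) _ _ H1), (is_derive_unique (fun x : R => dy x) _ _ H2),
        (is_derive_unique (fun x : R => z x) _ _ H3), (is_derive_unique (fun x : R => dz x) _ _ H4). ring.
  - intros t Ht My Mz. unfold sqdist.
    pose proof (ppow_lipschitz p M _ _ Hp My Mz) as HP. fold L in HP.
    set (P := ppow p (y t) - ppow p (z t)) in *.
    set (d := y t - z t) in *. set (d' := dy t - dz t) in *.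
    assert (Hq : 0 <= m ^ 2 * exp (2 * m * t) <= E).
    { pose proof (pow_lt m 2 Hm). split; [ pose proof (exp_pos (2 * m * t)); nra | ].
      apply Rmult_le_compat_l; [ lra | ]. apply exp_le_of. nra. }
    set (q := m ^ 2 * exp (2 * m * t)) in *.
    replace (2 * d * d' + 2 * d' * (- a * d' + d - P + q * d))
      with ((4 + 2 * q) * (d * d') + (- 2 * d' * P - 2 * a * d' ^ 2)) by ring.
    assert (H1 : Rabs d * Rabs d' <= (d ^ 2 + d' ^ 2) / 2).
    { pose proof (pow2_ge_0 (Rabs d - Rabs d')). pose proof (pow2_abs d). pose proof (pow2_abs d'). nra. }
    assert (H2 : Rabs (d' * P) <= L * (Rabs d * Rabs d')).
    { rewrite Rabs_mult. pose proof (Rabs_pos d'). nra. }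
    rewrite <- Rabs_mult in H1, H2.
    pose proof (Rabs_pos (d * d')). pose proof (pow2_ge_0 d). pose proof (pow2_ge_0 d').
    apply Rabs_le_between in H2. pose proof (Rabs_maj2 (d * d')). pose proof (Rle_abs (d * d')).
    set (k := Rabs (d * d')) in *. set (kk := d * d') in *. set (kp := d' * P) in *.
    replace (- 2 * d' * P) with (- 2 * kp) by (unfold kp; ring).
    assert (HLk : L * k <= L * ((d ^ 2 + d' ^ 2) / 2)) by nra.
    assert (Hqk : Rabs ((4 + 2 * q) * kk) <= (4 + 2 * E) * ((d ^ 2 + d' ^ 2) / 2)).
    { rewrite Rabs_mult, (Rabs_pos_eq (4 + 2 * q)) by lra. fold k. nra. }
    apply Rabs_le_between in Hqk. apply Rabs_le_between. nra.
Qed.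

(* For a small [kappa] the quadratic form [d'^2/2 + b d^2/2 + kappa d d'] is a strict Lyapunov function. *)
Lemma damped_oscillator_decay (a b : R) : 0 < a -> 0 < b ->
  exists delta c C, 0 < delta /\ 0 < c /\ 0 < C /\
    forall (d d' e : R -> R) (s t : R), s <= t ->
      (forall x, s <= x <= t -> is_derive d x (d' x)) ->
      (forall x, s <= x <= t -> is_derive d' x (- a * d' x - b * d x + e x)) ->
      (forall x, s <= x <= t -> Rabs (e x) <= delta * Rabs (d x)) ->
      d t ^ 2 + d' t ^ 2 <= C * exp (- c * (t - s)) * (d s ^ 2 + d' s ^ 2).
Proof.
  intros Ha Hb.
  set (mu := Rmin 1 b).
  assert (Hmu : 0 < mu <= 1 /\ mu <= b).
  { unfold mu, Rmin. destruct (Rle_dec 1 b); lra. }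
  set (Q := 1 + a ^ 2 / b).
  assert (HQ : 1 <= Q).
  { assert (0 <= a ^ 2 / b) by (apply Rmult_le_pos; [ apply pow2_ge_0 | left; apply Rinv_0_lt_compat; lra ]).
    unfold Q; lra. }
  (* [k <= mu / 2] keeps the form comparable to [d^2 + d'^2]. [k * Q <= a / 4] lets the damping
     absorb [k d'^2] and the [a^2 / b] term that Young's inequality leaves from [- k a d d']. *)
  set (k := Rmin (mu / 2) (a / (4 * Q))).
  assert (Hk : 0 < k /\ k <= mu / 2 /\ k * Q <= a / 4).
  { assert (0 < a / (4 * Q)) by (apply Rdiv_lt_0_compat; nra).
    assert (a / (4 * Q) * Q = a / 4) by (field; nra).
    unfold k. pose proof (Rmin_l (mu / 2) (a / (4 * Q))). pose proof (Rmin_r (mu / 2) (a / (4 * Q))).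
    split; [ apply Rmin_pos; lra | ]. split; [ lra | nra ]. }
  (* The cross terms and the perturbation each consume at most a quarter of the dissipation rates
     [a] and [k * b]; half of each survives, which is the choice of [g]. *)
  set (delta := Rmin (a / 2) (k * b / 4)).
  assert (Hd : 0 < delta /\ delta <= a / 2 /\ delta <= k * b / 4).
  { unfold delta. split; [ apply Rmin_pos; nra | ]. split; [ apply Rmin_l | apply Rmin_r ]. }
  set (g := Rmin (a / 2) (k * b / 2)).
  assert (Hg : 0 < g /\ g <= a / 2 /\ g <= k * b / 2).
  { unfold g. split; [ apply Rmin_pos; nra | ]. split; [ apply Rmin_l | apply Rmin_r ]. }
  clearbody mu delta g.
  exists delta, (g / (1 + b)), (4 * (1 + b) / mu).
  split; [ apply Hd | ]. split; [ apply Rdiv_lt_0_compat; lra | ].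
  split; [ apply Rdiv_lt_0_compat; nra | ].
  intros d d' e s t Hst H1 H2 He.
  set (V := fun x => d' x ^ 2 / 2 + b * d x ^ 2 / 2 + k * d x * d' x).
  assert (Hlo : forall x, mu / 4 * (d x ^ 2 + d' x ^ 2) <= V x).
  { intros x. unfold V. assert (- (d x ^ 2 + d' x ^ 2) / 2 <= d x * d' x)
      by (pose proof (pow2_ge_0 (d x + d' x)); lra).
    pose proof (pow2_ge_0 (d x)). pose proof (pow2_ge_0 (d' x)).
    assert (k * (- (d x ^ 2 + d' x ^ 2) / 2) <= k * (d x * d' x)) by (apply Rmult_le_compat_l; lra).
    assert (k * (d x ^ 2 + d' x ^ 2) <= mu / 2 * (d x ^ 2 + d' x ^ 2)) by (apply Rmult_le_compat_r; lra).
    assert (mu * d x ^ 2 <= b * d x ^ 2) by (apply Rmult_le_compat_r; lra).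
    assert (mu * d' x ^ 2 <= 1 * d' x ^ 2) by (apply Rmult_le_compat_r; lra). lra. }
  assert (Hup : forall x, V x <= (1 + b) * (d x ^ 2 + d' x ^ 2)).
  { intros x. unfold V. assert (d x * d' x <= (d x ^ 2 + d' x ^ 2) / 2)
      by (pose proof (pow2_ge_0 (d x - d' x)); lra).
    pose proof (pow2_ge_0 (d x)). pose proof (pow2_ge_0 (d' x)).
    assert (k * (d x * d' x) <= k * ((d x ^ 2 + d' x ^ 2) / 2)) by (apply Rmult_le_compat_l; lra).
    assert (k * (d x ^ 2 + d' x ^ 2) <= 1 / 2 * (d x ^ 2 + d' x ^ 2)) by (apply Rmult_le_compat_r; lra).
    assert (0 <= b * d' x ^ 2) by (apply Rmult_le_pos; lra).
    assert (0 <= b * d x ^ 2) by (apply Rmult_le_pos; lra). lra. }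
  assert (HG : V t <= exp (- (g / (1 + b)) * (t - s)) * V s).
  { apply (gronwall V (fun x => d' x * (- a * d' x - b * d x + e x) + b * d x * d' x
      + k * (d' x ^ 2 + d x * (- a * d' x - b * d x + e x)))); [ exact Hst | | ].
    - intros x Hx. specialize (H1 x Hx). specialize (H2 x Hx). unfold V. auto_derive.
      + repeat split; eexists; eassumption.
      + rewrite (is_derive_unique (fun z : R => d z) _ _ H1), (is_derive_unique (fun z : R => d' z) _ _ H2). field.
    - intros x Hx. specialize (He x Hx). specialize (Hup x).
      apply Rle_trans with (- g * (d x ^ 2 + d' x ^ 2)).
      2:{ apply (Rmult_le_compat_l (g / (1 + b))) in Hup; [ | left; apply Rdiv_lt_0_compat; lra ].
          replace (g / (1 + b) * ((1 + b) * (d x ^ 2 + d' x ^ 2))) with (g * (d x ^ 2 + d' x ^ 2)) in Hup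
            by (field; lra). lra. }
      generalize dependent (e x). intros ex He. generalize dependent (d x). intros u _ He.
      generalize dependent (d' x). intros v. clear - Ha Hb Hmu HQ Hk Hd Hg He.
      assert (E1 : v * ex <= delta * ((u ^ 2 + v ^ 2) / 2)).
      { apply Rle_trans with (Rabs v * Rabs ex); [ rewrite <- Rabs_mult; apply Rle_abs | ].
        apply Rle_trans with (delta * (Rabs u * Rabs v)).
        - pose proof (Rabs_pos v). nra.
        - apply Rmult_le_compat_l; [ lra | ]. pose proof (pow2_abs u). pose proof (pow2_abs v).
          pose proof (pow2_ge_0 (Rabs u - Rabs v)). nra. }
      assert (E2 : u * ex <= delta * u ^ 2).
      { apply Rle_trans with (Rabs u * Rabs ex); [ rewrite <- Rabs_mult; apply Rle_abs | ].
        rewrite <- (pow2_abs u). pose proof (Rabs_pos u). nra. }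
      assert (E3 : - a * (u * v) <= b * u ^ 2 / 4 + a ^ 2 / b * v ^ 2).
      { assert (0 <= (u * b / 2 + a * v) ^ 2 / b).
        { apply Rmult_le_pos; [ apply pow2_ge_0 | left; apply Rinv_0_lt_compat; lra ]. }
        replace ((u * b / 2 + a * v) ^ 2 / b) with (b * u ^ 2 / 4 + a * (u * v) + a ^ 2 / b * v ^ 2) in H
          by (field; lra). lra. }
      pose proof (pow2_ge_0 u). pose proof (pow2_ge_0 v).
      assert (E4 : k * (- a * (u * v)) <= k * (b * u ^ 2 / 4 + a ^ 2 / b * v ^ 2)) by nra.
      assert (E5 : k * (u * ex) <= k * (delta * u ^ 2)) by nra.
      assert (E6 : k * v ^ 2 + k * (a ^ 2 / b) * v ^ 2 <= a / 4 * v ^ 2).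
      { replace (k * v ^ 2 + k * (a ^ 2 / b) * v ^ 2) with (k * Q * v ^ 2) by (unfold Q; ring). nra. }
      assert (E7 : delta * u ^ 2 <= k * b / 4 * u ^ 2) by (apply Rmult_le_compat_r; lra).
      assert (E8 : delta * v ^ 2 <= a / 2 * v ^ 2) by (apply Rmult_le_compat_r; lra).
      assert (E9 : k * (delta * u ^ 2) <= 1 / 2 * (delta * u ^ 2)).
      { apply Rmult_le_compat_r; [ apply Rmult_le_pos | ]; lra. }
      assert (g * u ^ 2 <= k * b / 2 * u ^ 2) by (apply Rmult_le_compat_r; lra).
      assert (g * v ^ 2 <= a / 2 * v ^ 2) by (apply Rmult_le_compat_r; lra).
      lra. }
  specialize (Hlo t). specialize (Hup s). set (X := exp _) in *.
  assert (HX : 0 < X) by apply exp_pos.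
  apply Rmult_le_reg_l with (mu / 4); [ lra | ].
  replace (mu / 4 * (4 * (1 + b) / mu * X * (d s ^ 2 + d' s ^ 2)))
    with (X * ((1 + b) * (d s ^ 2 + d' s ^ 2))) by (field; lra).
  apply Rle_trans with (1 := Hlo). apply Rle_trans with (1 := HG).
  apply Rmult_le_compat_l; lra.
Qed.

(** Since [y^p] has slope [p] at [1], the difference [d] of two solutions satisfies
    [d'' + a d' + (p - 1) d = e]. Half of the admissible size of [e] goes to the linearization
    error, fixing [rho], and half to the forcing, fixing [T]. *)
Lemma emden_contraction (a m p : R) : 1 < p -> 0 < a -> 0 < m ->
  exists rho c C T, 0 < rho /\ 0 < c /\ 0 < C /\
    forall y dy z dz s t, emden a m p y dy -> emden a m p z dz -> s <= t <= T ->
      (forall x, s <= x <= t -> Rabs (y x - 1) <= rho /\ Rabs (z x - 1) <= rho) ->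
      sqdist y dy z dz t <= C * exp (- c * (t - s)) * sqdist y dy z dz s.
Proof.
  intros Hp Ha Hm.
  destruct (damped_oscillator_decay a (p - 1) Ha ltac:(lra)) as (delta & c & C & Hd & Hc & HC & H).
  destruct (ppow_linearization_at_1 p (delta / 2) Hp ltac:(lra)) as (rho & Hrho & Hlin).
  pose proof (pow_lt m 2 Hm) as Hm2.
  destruct (exp_eventually_le (2 * m) (delta / 2 / m ^ 2) ltac:(lra)
    ltac:(apply Rdiv_lt_0_compat; lra)) as (T & HT).
  exists rho, c, C, T. repeat split; try assumption.
  intros y dy z dz s t Hy Hz Hst Hclose. unfold sqdist.
  apply (H (fun x => y x - z x) (fun x => dy x - dz x)
    (fun x => - (ppow p (y x) - ppow p (z x) - p * (y x - z x)) + m ^ 2 * exp (2 * m * x) * (y x - z x)));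
    [ lra | | | ].
  - intros x _. apply @is_derive_minus; [ apply Hy | apply Hz ].
  - intros x _. destruct (Hy x) as [_ H1]. destruct (Hz x) as [_ H2].
    evar_last.
    { apply @is_derive_minus; [ exact H1 | exact H2 ]. }
    unfold minus, plus, opp; simpl. ring.
  - intros x Hx. destruct (Hclose x Hx) as [C1 C2]. specialize (Hlin _ _ C1 C2).
    apply Rle_trans with (1 := Rabs_triang _ _). rewrite Rabs_Ropp.
    rewrite (Rabs_mult (m ^ 2 * exp (2 * m * x))), (Rabs_pos_eq (m ^ 2 * exp (2 * m * x))).
    2:{ apply Rmult_le_pos; [ lra | left; apply exp_pos ]. }
    assert (m ^ 2 * exp (2 * m * x) <= delta / 2).
    { specialize (HT x ltac:(lra)). apply (Rmult_le_compat_l (m ^ 2)) in HT; [ | lra ].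
      replace (m ^ 2 * (delta / 2 / m ^ 2)) with (delta / 2) in HT by (field; lra). exact HT. }
    pose proof (Rabs_pos (y x - z x)). nra.
Qed.

(** * Trapping near the equilibrium *)

Definition potential (p y : R) : R := y * ppow p y / (p + 1) - y ^ 2 / 2.

Lemma potential_is_derive (p y : R) : 1 < p -> is_derive (potential p) y (ppow p y - y).
Proof.
  intros Hp. unfold potential. apply @is_derive_minus; [ apply primitive_is_derive, Hp | ].
  auto_derive; [ exact I | field ].
Qed.

Lemma potential_deriv_neg (p y : R) : 1 < p -> 0 < y < 1 -> ppow p y - y < 0.
Proof.
  intros Hp Hy. rewrite <- ppow_pred.
  pose proof (ppow_lt (p - 1) y 1 ltac:(lra) ltac:(lra) ltac:(lra)) as H. rewrite ppow_1 in H. nra.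
Qed.

Lemma potential_deriv_pos (p y : R) : 1 < p -> 1 < y -> 0 < ppow p y - y.
Proof.
  intros Hp Hy. rewrite <- ppow_pred.
  pose proof (ppow_lt (p - 1) 1 y ltac:(lra) ltac:(lra) ltac:(lra)) as H. rewrite ppow_1 in H. nra.
Qed.

Lemma potential_increasing (p x y : R) : 1 < p -> 1 <= x -> x < y -> potential p x < potential p y.
Proof.
  intros Hp Hx Hxy.
  destruct (mvt (potential p) (fun y => ppow p y - y) x y Hxy) as (c & Hc & Hc').
  - intros; apply potential_is_derive, Hp.
  - pose proof (potential_deriv_pos p c Hp ltac:(lra)). nra.
Qed.

Lemma potential_decreasing (p x y : R) : 1 < p -> 0 < x -> x < y -> y <= 1 ->
  potential p y < potential p x.
Proof.
  intros Hp Hx Hxy Hy.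
  destruct (mvt (potential p) (fun y => ppow p y - y) x y Hxy) as (c & Hc & Hc').
  - intros; apply potential_is_derive, Hp.
  - pose proof (potential_deriv_neg p c Hp ltac:(lra)). nra.
Qed.

Lemma potential_min (p y : R) : 1 < p -> 0 < y -> potential p 1 <= potential p y.
Proof.
  intros Hp Hy. destruct (Rtotal_order y 1) as [H|[->|H]].
  - left; apply potential_decreasing; lra.
  - lra.
  - left; apply potential_increasing; lra.
Qed.

(** The potential is strictly monotone on either side of [1], so half the lower of the barriers at
    [1 - e] and [1 + e] will do; the cap [e <= 1 / 2] keeps [1 - e] positive. *)
Lemma potential_well (p eps : R) : 1 < p -> 0 < eps -> exists mu, 0 < mu /\
  forall y, 0 < y -> potential p y <= potential p 1 + mu -> Rabs (y - 1) <= eps.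
Proof.
  intros Hp He. set (e := Rmin eps (1 / 2)).
  assert (H : 0 < e /\ e <= eps /\ e <= 1 / 2).
  { unfold e. split; [ apply Rmin_pos; lra | ]. split; [ apply Rmin_l | apply Rmin_r ]. }
  clearbody e.
  pose proof (potential_increasing p 1 (1 + e) Hp ltac:(lra) ltac:(lra)) as H1.
  pose proof (potential_decreasing p (1 - e) 1 Hp ltac:(lra) ltac:(lra) ltac:(lra)) as H2.
  set (b := Rmin (potential p (1 + e) - potential p 1) (potential p (1 - e) - potential p 1)).
  assert (Hb : 0 < b) by (unfold b; apply Rmin_pos; lra).
  pose proof (Rmin_l (potential p (1 + e) - potential p 1) (potential p (1 - e) - potential p 1)) as H3.
  pose proof (Rmin_r (potential p (1 + e) - potential p 1) (potential p (1 - e) - potential p 1)) as H4.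
  fold b in H3, H4.
  exists (b / 2). split; [ lra | ]. intros y Hy Hpot. apply Rabs_le_between'. split.
  - destruct (Rle_lt_dec (1 - e) y) as [|Hl]; [ lra | ].
    pose proof (potential_decreasing p y (1 - e) Hp Hy Hl ltac:(lra)). lra.
  - destruct (Rle_lt_dec y (1 + e)) as [|Hl]; [ lra | ].
    pose proof (potential_increasing p (1 + e) y Hp ltac:(lra) Hl). lra.
Qed.

(** Turns a small force into a small excess of potential. The force also vanishes at the saddle
    [y = 0], hence the lower bound [c]. Between [1] and [y] the factor [|x^(p-1) - 1|] is largest at
    [y], which controls the mean value point. *)
Lemma potential_gap (p c M y : R) : 1 < p -> 0 < c -> 1 <= M -> c <= y <= M ->
  potential p y - potential p 1 <= M ^ 2 / c * Rabs (ppow p y - y).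
Proof.
  intros Hp Hc HM Hy.
  assert (HP : Rabs (ppow (p - 1) y - 1) <= Rabs (ppow p y - y) / c).
  { rewrite <- (ppow_pred p y). replace (y * ppow (p - 1) y - y) with (y * (ppow (p - 1) y - 1)) by ring.
    rewrite Rabs_mult, (Rabs_pos_eq y) by lra. pose proof (Rabs_pos (ppow (p - 1) y - 1)).
    apply Rle_div_r; [ lra | ]. nra. }
  set (r := Rabs (ppow p y - y)) in *.
  assert (Hr : 0 <= r) by apply Rabs_pos.
  destruct (MVT_gen (potential p) 1 y (fun z => ppow p z - z)) as (x & Hx & Heq).
  - intros; apply potential_is_derive, Hp.
  - intros x _. apply continuity_pt_filterlim, @ex_derive_continuous.
    eexists; apply potential_is_derive, Hp.
  - rewrite Heq. apply Rle_trans with (1 := Rle_abs _). rewrite Rabs_mult.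
    assert (0 < x <= M) by (revert Hx; unfold Rmin, Rmax; destruct (Rle_dec 1 y); lra).
    assert (Hxy : Rabs (ppow (p - 1) x - 1) <= r / c).
    { apply Rle_trans with (2 := HP).
      destruct (Rle_dec 1 y) as [H1|H1].
      - rewrite Rmin_left, Rmax_right in Hx by lra.
        pose proof (ppow_le (p - 1) 1 x ltac:(lra) ltac:(lra)).
        pose proof (ppow_le (p - 1) x y ltac:(lra) ltac:(lra)).
        rewrite ppow_1 in *. rewrite 2!Rabs_pos_eq; lra.
      - rewrite Rmin_right, Rmax_left in Hx by lra.
        pose proof (ppow_le (p - 1) x 1 ltac:(lra) ltac:(lra)).
        pose proof (ppow_le (p - 1) y x ltac:(lra) ltac:(lra)).
        rewrite ppow_1 in *. rewrite 2!Rabs_left1; lra. }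
    rewrite <- (ppow_pred p x). replace (x * ppow (p - 1) x - x) with (x * (ppow (p - 1) x - 1)) by ring.
    rewrite Rabs_mult, (Rabs_pos_eq x) by lra.
    assert (Rabs (y - 1) <= M) by (apply Rabs_le_between'; lra).
    replace (M ^ 2 / c * r) with (M * (r / c) * M) by (field; lra).
    pose proof (Rabs_pos (ppow (p - 1) x - 1)). pose proof (Rabs_pos (y - 1)).
    apply Rmult_le_compat; [ nra | lra | | lra ].
    apply Rmult_le_compat; lra.
Qed.

Lemma energy_potential (m p : R) (y dy : R -> R) (t : R) :
  energy m p y dy t = dy t ^ 2 / 2 + potential p (y t) - m ^ 2 * exp (2 * m * t) * y t ^ 2 / 2.
Proof. unfold energy, potential. ring. Qed.

(** With nonpositive energy, [y^(p+1)] and [y'^2] are dominated by [(1 + Q) y^2]; division by [y^2]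
    gives bounds that do not see the initial value of the solution. *)
Lemma nonpos_energy_bounds (m p Q t : R) (y dy : R -> R) : 1 < p ->
  m ^ 2 * exp (2 * m * t) <= Q -> 0 < y t -> energy m p y dy t <= 0 ->
  ppow (p - 1) (y t) <= (p + 1) / 2 * (1 + Q) /\
  y t <= Rpower ((p + 1) / 2 * (1 + Q)) (/ (p - 1)) /\
  dy t ^ 2 <= (1 + Q) * y t ^ 2.
Proof.
  intros Hp HQ Hy H. unfold energy in H. rewrite <- (ppow_pred p (y t)) in H.
  set (x := y t) in *. set (q := m ^ 2 * exp (2 * m * t)) in *.
  pose proof (ppow_gt0 (p - 1) x Hy) as HP. set (P := ppow (p - 1) x) in *.
  replace (dy t ^ 2 / 2 - x ^ 2 / 2 + x * (x * P) / (p + 1) - q * x ^ 2 / 2)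
    with (dy t ^ 2 / 2 - (1 + q) * x ^ 2 / 2 + x ^ 2 * (P / (p + 1))) in H by (field; lra).
  pose proof (pow2_ge_0 (dy t)). pose proof (pow_lt x 2 Hy).
  assert (HP' : 0 < P / (p + 1)) by (apply Rdiv_lt_0_compat; lra).
  assert (HPQ : P <= (p + 1) / 2 * (1 + Q)).
  { assert (P / (p + 1) <= (1 + Q) / 2) by nra.
    replace P with ((p + 1) * (P / (p + 1))) by (field; lra). nra. }
  split; [ exact HPQ | ]. split.
  - apply Rnot_lt_le; intros Hl. apply (ppow_lt (p - 1)) in Hl; [ | lra | apply exp_pos ].
    rewrite (ppow_pos _ (Rpower _ _)) in Hl by apply exp_pos.
    fold x P in Hl. rewrite Rpower_mult, Rinv_l, Rpower_1 in Hl; lra.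
  - nra.
Qed.

(* Strict Lyapunov function [energy + kappa y' (y^p - y)]: over a long time interval its derivative
   is small somewhere, and there [(y, y')] is close to the equilibrium [(1, 0)]; the plain energy
   then keeps the orbit close. *)
Lemma emden_trapping (a m p eta T0 eps : R) :
  1 < p -> 0 < a -> 0 < m -> 0 < eta -> m ^ 2 * exp (2 * m * T0) <= 1 -> 0 < eps ->
  exists T K, T <= T0 /\ 0 < K /\ forall y dy t1, emden a m p y dy ->
    (forall t, t <= T0 -> 0 < y t) -> (forall t, energy m p y dy t <= 0) ->
    energy m p y dy t1 <= - eta ->
    forall t, t1 + K <= t <= T -> Rabs (y t - 1) <= eps /\ Rabs (dy t) <= eps.
Proof.
  intros Hp Ha Hm Heta HT0 Heps.
  destruct (potential_well p eps Hp Heps) as (mu & Hmu & Hwell).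
  (* Energy budget, later split into thirds: kinetic energy and potential excess at the good time
     [xi], and forcing at the final time [t]. *)
  set (e := Rmin mu (eps ^ 2 / 2)).
  assert (He : 0 < e /\ e <= mu /\ e <= eps ^ 2 / 2).
  { unfold e. pose proof (pow_lt eps 2 Heps). split; [ apply Rmin_pos; lra | ]. split; [ apply Rmin_l | apply Rmin_r ]. }
  set (M := Rpower ((p + 1) / 2 * (1 + 1)) (/ (p - 1))).
  assert (HM : 1 <= M).
  { unfold M, Rpower. apply Rle_trans with (exp 0); [ rewrite exp_0; lra | ]. apply exp_le_of. apply Rmult_le_pos.
    - left; apply Rinv_0_lt_compat; lra.
    - rewrite <- ln_1. left; apply ln_increasing; lra. }
  (* Energy at most [- eta] with forcing at most [1] forces [y^2 >= eta]: the lost energy keeps the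
     orbit away from the saddle. *)
  set (c := Rmin 1 (sqrt eta)).
  assert (Hc : 0 < c /\ c <= 1 /\ c <= sqrt eta).
  { unfold c. split; [ apply Rmin_pos; [ lra | apply sqrt_lt_R0, Heta ] | ].
    split; [ apply Rmin_l | apply Rmin_r ]. }
  (* [B] bounds the coefficient of [y'^2] created by differentiating [y' (y^p - y)]; [k = a / (2 B)]
     spends exactly half of the damping on it. *)
  set (B := p * (p + 1) + 1 + a ^ 2).
  assert (HB : 1 < B) by (unfold B; pose proof (pow2_ge_0 a); nra).
  set (k := a / (2 * B)).
  assert (Hk : 0 < k) by (apply Rdiv_lt_0_compat; lra).
  assert (HkB : k * B = a / 2) by (unfold k; field; lra).
  (* The force size that [potential_gap] converts into a potential excess of [e / 3]. *)
  set (z := c * e / (3 * M ^ 2)).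
  assert (HM2 : 1 <= M ^ 2) by nra.
  assert (Hz : 0 < z) by (apply Rdiv_lt_0_compat; nra).
  set (rho := Rmin (a * e / 3) (k / 2 * z ^ 2)).
  assert (Hrho : 0 < rho /\ rho <= a * e / 3 /\ rho <= k / 2 * z ^ 2).
  { unfold rho. pose proof (pow_lt z 2 Hz).
    split; [ apply Rmin_pos; nra | ]. split; [ apply Rmin_l | apply Rmin_r ]. }
  clearbody e c rho.
  set (C0 := M ^ 2 + k * (2 * M * (M * (p + 2)))).
  assert (HC0 : 0 < C0).
  { unfold C0. assert (0 < k * (2 * M * (M * (p + 2)))) by (apply Rmult_lt_0_compat; [ | assert (0 < M * (p + 2)) ]; nra). lra. }
  (* Forcing so weak that it costs at most [rho / 2] in the dissipation estimate and [e / 3] in the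
     energy comparison. *)
  set (q0 := Rmin (rho / (2 * (k * M ^ 2))) (2 * e / (3 * M ^ 2))).
  assert (HkM : 0 < k * M ^ 2) by nra.
  assert (Hq0 : 0 < q0 /\ k * M ^ 2 * q0 <= rho / 2 /\ q0 * M ^ 2 / 2 <= e / 3).
  { unfold q0. split; [ apply Rmin_pos; apply Rdiv_lt_0_compat; nra | ].
    pose proof (Rmin_l (rho / (2 * (k * M ^ 2))) (2 * e / (3 * M ^ 2))) as E1.
    pose proof (Rmin_r (rho / (2 * (k * M ^ 2))) (2 * e / (3 * M ^ 2))) as E2.
    fold q0 in E1, E2 |- *. split.
    - apply (Rmult_le_compat_l (k * M ^ 2)) in E1; [ | lra ].
      replace (k * M ^ 2 * (rho / (2 * (k * M ^ 2)))) with (rho / 2) in E1 by (field; lra). exact E1.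
    - apply (Rmult_le_compat_r (M ^ 2)) in E2; [ | lra ].
      replace (2 * e / (3 * M ^ 2) * M ^ 2) with (2 * e / 3) in E2 by (field; lra). lra. }
  clearbody q0.
  pose proof (pow_lt m 2 Hm) as Hm2.
  destruct (exp_eventually_le (2 * m) (q0 / m ^ 2) ltac:(lra) ltac:(apply Rdiv_lt_0_compat; lra)) as (T1 & HT1).
  (* The modified energy is at most [C0] in absolute value, so over a time [K = 4 C0 / rho] its mean
     rate of decrease is at most [2 C0 / K = rho / 2]; the mean value theorem supplies the good
     time. *)
  exists (Rmin T0 T1), (4 * C0 / rho).
  assert (HK : 0 < 4 * C0 / rho) by (apply Rdiv_lt_0_compat; lra).
  split; [ apply Rmin_l | ]. split; [ exact HK | ].
  (* The algebraic core, with [u, v, r, P, q, D] standing for [y], [y'], [y^(p-1)], the force, the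
     forcing coefficient and the forcing dissipation. The useful term [- k P^2] comes from [y''] in
     the derivative of [y' P]. *)
  assert (Hquad : forall u v r P q D, c <= u <= M -> 0 <= r <= p + 1 -> 0 < q <= q0 -> q <= 1 -> 0 <= D ->
     - (- a * v ^ 2 - D + k * ((- a * v - P + q * u) * P + v * ((p * r - 1) * v))) <= rho / 2 ->
     a / 2 * v ^ 2 + k / 2 * P ^ 2 <= rho).
  { clear - Hp Ha Hc HM HB Hk HkB Hrho Hq0 HM2 HkM. intros u v r P q D Hu Hr Hq Hq1 HD HdL.
    assert (F1 : - a * v * P <= P ^ 2 / 4 + a ^ 2 * v ^ 2)
      by (pose proof (pow2_ge_0 (P / 2 + a * v)); lra).
    assert (F2 : q * u * P <= P ^ 2 / 4 + q ^ 2 * u ^ 2)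
      by (pose proof (pow2_ge_0 (P / 2 - q * u)); lra).
    assert (F3 : q ^ 2 * u ^ 2 <= q0 * M ^ 2).
    { apply Rmult_le_compat; [ apply pow2_ge_0 | apply pow2_ge_0 | nra | nra ]. }
    assert (F4 : (p * r - 1) * v ^ 2 <= (p * (p + 1) + 1) * v ^ 2).
    { apply Rmult_le_compat_r; [ apply pow2_ge_0 | ]. nra. }
    assert (F5 : (- a * v - P + q * u) * P + v * ((p * r - 1) * v) <= - P ^ 2 / 2 + B * v ^ 2 + q0 * M ^ 2)
      by (unfold B; lra).
    apply (Rmult_le_compat_l k) in F5; [ | lra ].
    assert (F6 : k * (B * v ^ 2) = a / 2 * v ^ 2) by (rewrite <- HkB; ring).
    lra. }
  intros y dy t1 Hy Hpos Hen Ht1 t Ht.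
  pose proof (Rmin_l T0 T1). pose proof (Rmin_r T0 T1). set (T := Rmin T0 T1) in *. clearbody T.
  set (K := 4 * C0 / rho) in *.
  assert (HCK : 2 * C0 / K = rho / 2) by (unfold K; field; lra).
  clearbody K.
  set (q := fun t => m ^ 2 * exp (2 * m * t)).
  assert (Hq : forall x, x <= T -> 0 < q x /\ q x <= q0 /\ q x <= 1).
  { intros x Hx. unfold q. pose proof (exp_pos (2 * m * x)). split; [ nra | ]. split.
    - specialize (HT1 x ltac:(lra)). apply (Rmult_le_compat_l (m ^ 2)) in HT1; [ | lra ].
      replace (m ^ 2 * (q0 / m ^ 2)) with q0 in HT1 by (field; lra). exact HT1.
    - apply Rle_trans with (2 := HT0). apply Rmult_le_compat_l; [ lra | ]. apply exp_le_of. nra. }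
  assert (Hbd : forall x, t1 <= x <= T -> ppow (p - 1) (y x) <= p + 1 /\ c <= y x <= M /\
      Rabs (dy x) <= 2 * M /\ - M ^ 2 <= energy m p y dy x).
  { intros x Hx. destruct (Hq x ltac:(lra)) as (Q1 & Q2 & Q3).
    pose proof (Hpos x ltac:(lra)) as Hyx.
    destruct (nonpos_energy_bounds m p 1 x y dy Hp Q3 Hyx (Hen x)) as (B1 & B2 & B3). fold M in B2.
    split; [ lra | ].
    assert (Hxe : energy m p y dy x <= - eta).
    { apply Rle_trans with (2 := Ht1). apply (energy_antitone a); try assumption; lra. }
    assert (Hlo : - (1 + q x) * y x ^ 2 / 2 <= energy m p y dy x).
    { unfold energy. fold (q x). pose proof (pow2_ge_0 (dy x)).
      assert (0 <= y x * ppow p (y x) / (p + 1)).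
      { apply Rdiv_le_0_compat; [ | lra ]. apply Rmult_le_pos; [ lra | apply ppow_ge0 ]. }
      lra. }
    assert (y x ^ 2 <= M ^ 2) by (apply pow_incr; lra).
    assert ((1 + q x) * y x ^ 2 <= 2 * y x ^ 2)
      by (apply Rmult_le_compat_r; [ apply pow2_ge_0 | lra ]).
    split; [ split | split ].
    - apply Rle_trans with (sqrt eta); [ lra | ]. rewrite <- (sqrt_pow2 (y x)) by lra. apply sqrt_le_1_alt; lra.
    - exact B2.
    - apply Rabs_le_of_sq; lra.
    - lra. }
  set (P := fun x => ppow p (y x) - y x).
  set (L := fun x => energy m p y dy x + k * (dy x * P x)).
  set (dL := fun x => - a * dy x ^ 2 - m ^ 3 * exp (2 * m * x) * y x ^ 2
     + k * ((- a * dy x - P x + q x * y x) * P x + dy x * ((p * ppow (p - 1) (y x) - 1) * dy x))).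
  assert (HL : forall x, is_derive L x (dL x)).
  { intros x. apply @is_derive_plus; [ apply (energy_is_derive a); assumption | ].
    destruct (Hy x) as [H1 H2]. unfold P. auto_derive.
    - repeat split; try (eexists; eassumption). eexists; apply ppow_is_derive, Hp.
    - rewrite (is_derive_unique (fun z : R => y z) _ _ H1), (is_derive_unique (fun z : R => dy z) _ _ H2).
      rewrite (is_derive_unique (fun z : R => ppow p z) _ _ (ppow_is_derive p (y x) Hp)).
      unfold q. ring. }
  destruct (mvt L dL t1 (t1 + K) ltac:(lra) ltac:(auto)) as (xi & Hxi & Hxi').
  assert (HLb : forall x, t1 <= x <= T -> Rabs (L x) <= C0).
  { intros x Hx. destruct (Hbd x Hx) as (B1 & B2 & B3 & B4). specialize (Hen x).
    apply Rle_trans with (1 := Rabs_triang _ _). unfold C0. apply Rplus_le_compat.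
    - apply Rabs_le_between; lra.
    - rewrite 2!Rabs_mult, (Rabs_pos_eq k) by lra. apply Rmult_le_compat_l; [ lra | ].
      apply Rmult_le_compat; [ apply Rabs_pos | apply Rabs_pos | exact B3 | ].
      unfold P. rewrite <- (ppow_pred p). pose proof (ppow_ge0 (p - 1) (y x)).
      apply Rabs_le_between. split; nra. }
  assert (Hdis : a / 2 * dy xi ^ 2 + k / 2 * P xi ^ 2 <= rho).
  { assert (HdL : - dL xi <= rho / 2).
    { rewrite <- HCK. apply Rle_div_r; [ lra | ].
      pose proof (HLb t1 ltac:(lra)) as E1. pose proof (HLb (t1 + K) ltac:(lra)) as E2.
      apply Rabs_le_between in E1. apply Rabs_le_between in E2.
      replace (t1 + K - t1) with K in Hxi by ring. lra. }
    destruct (Hbd xi ltac:(lra)) as (B1 & B2 & B3 & B4). destruct (Hq xi ltac:(lra)) as (Q1 & Q2 & Q3).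
    unfold dL in HdL. pose proof (ppow_ge0 (p - 1) (y xi)).
    assert (0 <= m ^ 3 * exp (2 * m * xi) * y xi ^ 2).
    { apply Rmult_le_pos; [ apply Rmult_le_pos; [ apply pow_le; lra | left; apply exp_pos ] | apply pow2_ge_0 ]. }
    apply (Hquad (y xi) (dy xi) (ppow (p - 1) (y xi)) (P xi) (q xi) (m ^ 3 * exp (2 * m * xi) * y xi ^ 2));
      try assumption; lra. }
  destruct (Hbd xi ltac:(lra)) as (_ & Bxi & _ & _).
  assert (Hdxi : dy xi ^ 2 / 2 <= e / 3).
  { assert (0 <= k / 2 * P xi ^ 2) by (apply Rmult_le_pos; [ lra | apply pow2_ge_0 ]).
    apply Rmult_le_reg_l with a; lra. }
  assert (HPxi : Rabs (P xi) <= z).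
  { assert (0 <= a / 2 * dy xi ^ 2) by (apply Rmult_le_pos; [ lra | apply pow2_ge_0 ]).
    assert (P xi ^ 2 <= z ^ 2) by (apply Rmult_le_reg_l with (k / 2); lra).
    apply Rabs_le_of_sq; lra. }
  assert (Hpxi : potential p (y xi) - potential p 1 <= e / 3).
  { apply Rle_trans with (1 := potential_gap p c M (y xi) Hp ltac:(lra) HM Bxi).
    apply (Rmult_le_compat_l (M ^ 2 / c)) in HPxi; [ | left; apply Rdiv_lt_0_compat; lra ].
    unfold P in HPxi. unfold z in HPxi.
    replace (M ^ 2 / c * (c * e / (3 * M ^ 2))) with (e / 3) in HPxi by (field; lra). exact HPxi. }
  assert (Hent : energy m p y dy t <= energy m p y dy xi) by (apply (energy_antitone a); try assumption; lra).
  rewrite 2!energy_potential in Hent. fold (q t) (q xi) in Hent.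
  destruct (Hbd t ltac:(lra)) as (_ & Bt & _ & _). destruct (Hq t ltac:(lra)) as (Q1 & Q2 & _).
  assert (q t * y t ^ 2 / 2 <= e / 3).
  { apply Rle_trans with (q0 * M ^ 2 / 2); [ | lra ].
    assert (y t ^ 2 <= M ^ 2) by (apply pow_incr; lra). pose proof (pow2_ge_0 (y t)). nra. }
  assert (0 <= q xi * y xi ^ 2 / 2).
  { destruct (Hq xi ltac:(lra)) as (Q3 & _). pose proof (pow2_ge_0 (y xi)). nra. }
  pose proof (pow2_ge_0 (dy t)).
  pose proof (potential_min p (y t) Hp ltac:(lra)).
  split.
  - apply Hwell; lra.
  - assert (dy t ^ 2 <= eps ^ 2) by lra. apply Rabs_le_of_sq; lra.
Qed.

(** * The singular solution and persistence of simple zeros *)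

Lemma bounded_on_interval (f : R -> R) (a b : R) : a <= b -> (forall x, continuous f x) ->
  exists M, forall x, a <= x <= b -> Rabs (f x) <= M.
Proof.
  intros Hab Hf.
  destruct (continuity_ab_maj (fun x => Rabs (f x)) a b Hab) as (x0 & H & _).
  - intros x _. apply continuity_pt_filterlim. apply (continuous_comp f Rabs); [ apply Hf | apply continuous_Rabs ].
  - exists (Rabs (f x0)). exact H.
Qed.

Lemma nonvanishing_lower_bound (f : R -> R) (a b : R) : a <= b -> (forall x, continuous f x) ->
  (forall x, a <= x <= b -> f x <> 0) -> exists mu, 0 < mu /\ forall x, a <= x <= b -> mu <= Rabs (f x).
Proof.
  intros Hab Hf Hn.
  destruct (continuity_ab_min (fun x => Rabs (f x)) a b Hab) as (x0 & H & Hx0).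
  - intros x _. apply continuity_pt_filterlim. apply (continuous_comp f Rabs); [ apply Hf | apply continuous_Rabs ].
  - exists (Rabs (f x0)). split; [ apply Rabs_pos_lt, Hn, Hx0 | exact H ].
Qed.

Lemma is_derive_continuous (f : R -> R) (x l : R) : is_derive f x l -> continuous f x.
Proof. intros H. apply @ex_derive_continuous. exists l; exact H. Qed.

(** Only [y] is assumed to converge. The mean value theorem gives a time in [[t - 1, t]] where [y']
    is small, and the integrating factor [exp (a t)] carries this to [t], because the remaining
    source [y - y^p + m^2 exp (2 m t) y] is small too. *)
Lemma emden_near_equilibrium (a m p eps : R) (y dy : R -> R) :
  1 < p -> 0 < a -> 0 < m -> emden a m p y dy ->
  (forall e, 0 < e -> exists T, forall t, t < T -> Rabs (y t - 1) < e) -> 0 < eps ->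
  exists T, forall t, t <= T -> Rabs (y t - 1) <= eps /\ Rabs (dy t) <= eps.
Proof.
  intros Hp Ha Hm Hy Hlim Heps.
  set (L := p * ppow (p - 1) 2).
  assert (HL : 0 <= L) by (unfold L; pose proof (ppow_ge0 (p - 1) 2); nra).
  set (e := Rmin 1 (eps / (2 * (3 + L)))).
  assert (He : 0 < e /\ e <= 1 /\ e * (3 + L) <= eps / 2).
  { assert (0 < eps / (2 * (3 + L))) by (apply Rdiv_lt_0_compat; lra).
    unfold e. split; [ apply Rmin_pos; lra | ]. split; [ apply Rmin_l | ].
    replace (eps / 2) with (eps / (2 * (3 + L)) * (3 + L)) by (field; lra).
    apply Rmult_le_compat_r; [ lra | apply Rmin_r ]. }
  clearbody e. destruct (Hlim e ltac:(lra)) as (T1 & HT1).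
  pose proof (pow_lt m 2 Hm) as Hm2.
  destruct (exp_eventually_le (2 * m) (eps / 4 / m ^ 2) ltac:(lra)
    ltac:(apply Rdiv_lt_0_compat; lra)) as (T2 & HT2).
  exists (Rmin (T1 - 1) T2). intros t Ht.
  pose proof (Rmin_l (T1 - 1) T2). pose proof (Rmin_r (T1 - 1) T2).
  assert (Hye : forall x, x <= t -> Rabs (y x - 1) < e) by (intros; apply HT1; lra).
  split.
  { specialize (Hye t ltac:(lra)). nra. }
  destruct (mvt y dy (t - 1) t ltac:(lra) ltac:(intros; apply Hy)) as (xi & Hxi & Hxi').
  destruct (mvt (fun x => exp (a * x) * dy x)
    (fun x => exp (a * x) * (y x - ppow p (y x) + m ^ 2 * exp (2 * m * x) * y x)) xi t)
    as (z & Hz & Hz'); [ lra | | ].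
  { intros x _. destruct (Hy x) as [_ H2]. auto_derive.
    - eexists; eassumption.
    - rewrite (is_derive_unique (fun x : R => dy x) _ _ H2). ring. }
  set (r := y z - ppow p (y z) + m ^ 2 * exp (2 * m * z) * y z) in *.
  assert (Hr : Rabs r <= e * (1 + L) + eps / 2).
  { specialize (Hye z ltac:(lra)). apply Rabs_lt_between in Hye.
    assert (HP : Rabs (ppow p (y z) - ppow p 1) <= L * Rabs (y z - 1)).
    { apply ppow_lipschitz; [ exact Hp | apply Rabs_le_between; lra | rewrite Rabs_R1; lra ]. }
    assert (L * Rabs (y z - 1) <= L * e).
    { apply Rmult_le_compat_l; [ exact HL | ]. apply Rabs_le_between; lra. }
    rewrite ppow_1 in HP.
    assert (Hq : 0 < m ^ 2 * exp (2 * m * z) <= eps / 4).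
    { pose proof (exp_pos (2 * m * z)). split; [ nra | ].
      specialize (HT2 z ltac:(lra)). apply (Rmult_le_compat_l (m ^ 2)) in HT2; [ | lra ].
      replace (m ^ 2 * (eps / 4 / m ^ 2)) with (eps / 4) in HT2 by (field; lra). exact HT2. }
    set (P := ppow p (y z)) in *. unfold r. set (q := m ^ 2 * exp (2 * m * z)) in *.
    apply Rabs_le_between. assert (HP' : Rabs (P - 1) <= L * e) by lra. apply Rabs_le_between in HP'.
    split; nra. }
  assert (Hdxi : Rabs (dy xi) <= 2 * e).
  { replace (dy xi) with ((y t - 1) - (y (t - 1) - 1)) by lra.
    pose proof (Hye t ltac:(lra)) as E1. pose proof (Hye (t - 1) ltac:(lra)) as E2.
    apply Rabs_lt_between in E1. apply Rabs_lt_between in E2. apply Rabs_le_between; lra. }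
  assert (Heq : dy t = exp (a * (xi - t)) * dy xi + exp (a * (z - t)) * (t - xi) * r).
  { apply Rmult_eq_reg_l with (exp (a * t)); [ | pose proof (exp_pos (a * t)); lra ].
    replace (a * (xi - t)) with (a * xi + - (a * t)) by ring.
    replace (a * (z - t)) with (a * z + - (a * t)) by ring. rewrite 2!exp_plus, exp_Ropp.
    replace (exp (a * t) * (exp (a * xi) * / exp (a * t) * dy xi + exp (a * z) * / exp (a * t) * (t - xi) * r))
      with (exp (a * xi) * dy xi + exp (a * z) * r * (t - xi)) by (field; apply Rgt_not_eq, exp_pos). lra. }
  assert (E1 : exp (a * (xi - t)) <= 1) by (rewrite <- exp_0; apply exp_le_of; nra).
  assert (E2 : exp (a * (z - t)) <= 1) by (rewrite <- exp_0; apply exp_le_of; nra).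
  pose proof (exp_pos (a * (xi - t))). pose proof (exp_pos (a * (z - t))).
  rewrite Heq. apply Rle_trans with (1 := Rabs_triang _ _).
  rewrite 3!Rabs_mult, (Rabs_pos_eq (exp _)), (Rabs_pos_eq (exp _)), (Rabs_pos_eq (t - xi)) by lra.
  pose proof (Rabs_pos (dy xi)). pose proof (Rabs_pos r).
  assert (exp (a * (xi - t)) * Rabs (dy xi) <= 1 * Rabs (dy xi)) by (apply Rmult_le_compat_r; lra).
  assert (exp (a * (z - t)) * (t - xi) * Rabs r <= 1 * Rabs r) by (apply Rmult_le_compat_r; nra).
  nra.
Qed.

(* A double zero of [y' - c y] forces [y] to be a multiple of [exp (c t)], i.e. [u] to be constant. *)
Lemma emden_critical_nondegenerate (a m p c : R) (y dy : R -> R) (t0 : R) :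
  1 < p -> 0 < a -> 0 < m -> 0 < c -> c ^ 2 + a * c = 1 -> c * (p - 1) = 2 * m ->
  emden a m p y dy -> (forall e, 0 < e -> exists T, forall t, t < T -> Rabs (y t - 1) < e) ->
  dy t0 = c * y t0 ->
  - a * dy t0 + y t0 - ppow p (y t0) + m ^ 2 * exp (2 * m * t0) * y t0 <> c * dy t0.
Proof.
  intros Hp Ha Hm Hc Hca Hcp Hy Hlim H1 H2.
  (* The relation [c ^ 2 + a * c = 1] removes the linear terms; what remains says [f (u) = 0] at
     this point. *)
  assert (H3 : ppow p (y t0) = m ^ 2 * exp (2 * m * t0) * y t0).
  { rewrite H1 in H2. assert ((c ^ 2 + a * c) * y t0 = y t0) by (rewrite Hca; ring). lra. }
  (* The constant [u] in these variables. Since [c * (p - 1) = 2 * m], the identity [H3] propagates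
     from [t0] to all times, so [z] is a solution with the same data at [t0]. *)
  set (z := fun t => y t0 * exp (c * (t - t0))).
  assert (Hz : emden a m p z (fun t => c * z t)).
  { assert (Hd : forall t, is_derive z t (c * z t)).
    { intros t. unfold z. auto_derive; [ exact I | unfold Rminus; ring ]. }
    intros t. split; [ apply Hd | ].
    assert (Hzt : ppow p (z t) = m ^ 2 * exp (2 * m * t) * z t).
    { unfold z. destruct (Rlt_dec 0 (y t0)) as [Hy0|Hy0].
      - rewrite <- (ppow_pred p (y t0)) in H3. rewrite <- (ppow_pred p (_ * _)).
        assert (H4 : ppow (p - 1) (y t0) = m ^ 2 * exp (2 * m * t0)) by nra.
        pose proof (exp_pos (c * (t - t0))).
        rewrite (ppow_pos _ (y t0 * exp _)) by nra.
        rewrite <- Rpower_mult_distr by lra. rewrite <- ppow_pos, H4 by lra.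
        replace (Rpower (exp (c * (t - t0))) (p - 1)) with (exp (2 * m * (t - t0))).
        + replace (2 * m * t) with (2 * m * t0 + 2 * m * (t - t0)) by ring. rewrite exp_plus. ring.
        + unfold Rpower. rewrite ln_exp. f_equal. rewrite <- Hcp. ring.
      - rewrite ppow_nonpos in H3 by lra.
        assert (y t0 = 0).
        { pose proof (exp_pos (2 * m * t0)). pose proof (pow_lt m 2 Hm).
          assert (0 < m ^ 2 * exp (2 * m * t0)) by nra. nra. }
        rewrite H, Rmult_0_l, ppow_nonpos; lra. }
    rewrite Hzt. evar_last; [ apply is_derive_scal, Hd | ]. simpl.
    replace (c * (c * z t)) with (c ^ 2 * z t) by ring.
    replace (c ^ 2) with (1 - a * c) by lra. ring. }
  assert (Heq : forall t, t <= t0 -> y t = z t).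
  { intros t Ht.
    destruct (bounded_on_interval y t t0 Ht) as (M1 & HM1).
    { intros x; apply (is_derive_continuous _ _ _ (proj1 (Hy x))). }
    destruct (bounded_on_interval z t t0 Ht) as (M2 & HM2).
    { intros x; apply (is_derive_continuous _ _ _ (proj1 (Hz x))). }
    destruct (sqdist_derivative_bound a m p (Rmax M1 M2) t0 Hp Ha Hm) as (K & HK & HV).
    destruct (HV y dy z (fun t => c * z t) Hy Hz) as (dV & HdV & HV').
    assert (HB : sqdist y dy z (fun t => c * z t) t
        <= exp (K * (t0 - t)) * sqdist y dy z (fun t => c * z t) t0).
    { apply (gronwall_backward _ dV); [ exact Ht | auto | ]. intros x Hx.
      specialize (HV' x ltac:(lra)
        ltac:(apply Rle_trans with (1 := HM1 x Hx); apply Rmax_l)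
        ltac:(apply Rle_trans with (1 := HM2 x Hx); apply Rmax_r)).
      apply Rabs_le_between in HV'. lra. }
    assert (Hz0 : z t0 = y t0) by (unfold z; rewrite Rminus_diag, Rmult_0_r, exp_0; ring).
    unfold sqdist in HB. rewrite Hz0, H1 in HB.
    replace ((y t0 - y t0) ^ 2 + (c * y t0 - c * y t0) ^ 2) with 0 in HB by ring.
    rewrite Rmult_0_r in HB. pose proof (pow2_ge_0 (dy t - c * z t)).
    assert ((y t - z t) ^ 2 = 0) by (pose proof (pow2_ge_0 (y t - z t)); lra). nra. }
  destruct (Hlim (1 / 2) ltac:(lra)) as (T1 & HT1).
  (* The contradiction is at [-oo], where [z] tends to [0] and [y] to [1]: this time makes
     [z <= 1 / 2] while [y > 1 / 2]. *)
  destruct (exp_eventually_le c (/ (2 * (1 + Rabs (y t0)) * exp (- (c * t0)))) Hc) as (T2 & HT2).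
  { apply Rinv_0_lt_compat. pose proof (Rabs_pos (y t0)). pose proof (exp_pos (- (c * t0))). nra. }
  set (t := Rmin (Rmin (T1 - 1) T2) t0).
  assert (Ht : t <= T1 - 1 /\ t <= T2 /\ t <= t0).
  { unfold t. pose proof (Rmin_l (Rmin (T1 - 1) T2) t0). pose proof (Rmin_r (Rmin (T1 - 1) T2) t0).
    pose proof (Rmin_l (T1 - 1) T2). pose proof (Rmin_r (T1 - 1) T2). lra. }
  clearbody t. specialize (HT1 t ltac:(lra)). specialize (HT2 t ltac:(lra)).
  rewrite (Heq t ltac:(lra)) in HT1. apply Rabs_lt_between in HT1.
  assert (z t <= 1 / 2); [ | lra ].
  unfold z. replace (c * (t - t0)) with (c * t + - (c * t0)) by ring. rewrite exp_plus.
  set (X := exp (c * t)) in *. assert (HX : 0 < X) by apply exp_pos.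
  set (Y := exp (- (c * t0))) in *. assert (HY : 0 < Y) by apply exp_pos.
  pose proof (Rle_abs (y t0)). pose proof (Rabs_pos (y t0)). set (A := Rabs (y t0)) in *.
  apply Rle_trans with ((1 + A) * (X * Y)).
  { apply Rmult_le_compat_r; [ | lra ]. left; apply Rmult_lt_0_compat; lra. }
  apply (Rmult_le_compat_l ((1 + A) * Y)) in HT2; [ | left; apply Rmult_lt_0_compat; lra ].
  replace ((1 + A) * Y * / (2 * (1 + A) * Y)) with (1 / 2) in HT2 by (field; lra). lra.
Qed.

(** * Persistence of simple zeros under C^1 perturbation, and uniqueness of the [n]-th critical
    point *)

Definition C1_close (phi dphi psi dpsi : R -> R) (a b delta : R) : Prop :=
  forall x, a <= x <= b -> Rabs (psi x - phi x) <= delta /\ Rabs (dpsi x - dphi x) <= delta.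

(** Near [t] the slope of [phi] is at least [c / 2]. Closeness [c / 4] of the slopes keeps [psi]
    increasing (uniqueness), and closeness [c * eps / 4] of the values keeps its signs at [t - eps]
    and [t + eps] (existence). *)
Lemma increasing_zero_persists (phi dphi : R -> R) (t : R) :
  (forall x, is_derive phi x (dphi x)) -> continuous dphi t -> phi t = 0 -> 0 < dphi t ->
  exists r, 0 < r /\ forall eps, 0 < eps <= r -> exists delta, 0 < delta /\
    forall psi dpsi, (forall x, is_derive psi x (dpsi x)) ->
      C1_close phi dphi psi dpsi (t - eps) (t + eps) delta ->
      exists z, t - eps < z < t + eps /\ psi z = 0 /\
        forall x, t - eps <= x <= t + eps -> psi x = 0 -> x = z.
Proof.
  intros Hd Hc H0 Hpos. set (c := dphi t) in *.
  apply continuity_pt_filterlim in Hc. destruct (Hc (c / 2) ltac:(lra)) as (d & Hd0 & Hcd).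
  assert (Hder : forall x, Rabs (x - t) <= d / 2 -> c / 2 <= dphi x).
  { intros x Hx. destruct (Req_dec x t) as [->|Hn]; [ fold c; lra | ].
    specialize (Hcd x). simpl in Hcd. unfold Rdist in Hcd. fold c in Hcd.
    assert (Hlt : Rabs (dphi x - c) < c / 2).
    { apply Hcd. split; [ split; [ exact I | congruence ] | lra ]. }
    apply Rabs_lt_between in Hlt. lra. }
  exists (d / 2). split; [ lra | ]. intros eps Heps.
  pose proof (Rmin_l (c / 4) (c * eps / 4)) as M1. pose proof (Rmin_r (c / 4) (c * eps / 4)) as M2.
  exists (Rmin (c / 4) (c * eps / 4)). split; [ apply Rmin_pos; nra | ].
  set (delta := Rmin (c / 4) (c * eps / 4)) in *.
  intros psi dpsi Hpsi Hclose.
  assert (Hdpsi : forall x, t - eps <= x <= t + eps -> 0 < dpsi x).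
  { intros x Hx. destruct (Hclose x Hx) as [_ H]. apply Rabs_le_between in H.
    specialize (Hder x ltac:(apply Rabs_le_between'; lra)). lra. }
  assert (Hright : 0 < psi (t + eps)).
  { destruct (mvt phi dphi t (t + eps) ltac:(lra) ltac:(auto)) as (x & Hx & Hx').
    specialize (Hder x ltac:(apply Rabs_le_between'; lra)).
    destruct (Hclose (t + eps) ltac:(lra)) as [H _]. apply Rabs_le_between in H. nra. }
  assert (Hleft : psi (t - eps) < 0).
  { destruct (mvt phi dphi (t - eps) t ltac:(lra) ltac:(auto)) as (x & Hx & Hx').
    specialize (Hder x ltac:(apply Rabs_le_between'; lra)).
    destruct (Hclose (t - eps) ltac:(lra)) as [H _]. apply Rabs_le_between in H. nra. }
  destruct (IVT_gen psi (t - eps) (t + eps) 0) as (z & Hz & Hz0).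
  { intros x. apply continuity_pt_filterlim, (is_derive_continuous _ _ _ (Hpsi x)). }
  { rewrite Rmin_left, Rmax_right; lra. }
  rewrite Rmin_left, Rmax_right in Hz by lra.
  exists z. split; [ | split; [ exact Hz0 | ] ].
  { destruct Hz as [[Hz1|Hz1] [Hz2|Hz2]]; subst; lra. }
  intros x Hx Hx0. destruct (Rtotal_order x z) as [H|[H|H]]; [ exfalso | exact H | exfalso ].
  - destruct (mvt psi dpsi x z H ltac:(auto)) as (w & Hw & Hw').
    specialize (Hdpsi w ltac:(lra)). nra.
  - destruct (mvt psi dpsi z x H ltac:(auto)) as (w & Hw & Hw').
    specialize (Hdpsi w ltac:(lra)). nra.
Qed.

Lemma simple_zero_persists (phi dphi : R -> R) (t : R) :
  (forall x, is_derive phi x (dphi x)) -> continuous dphi t -> phi t = 0 -> dphi t <> 0 ->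
  exists r, 0 < r /\ forall eps, 0 < eps <= r -> exists delta, 0 < delta /\
    forall psi dpsi, (forall x, is_derive psi x (dpsi x)) ->
      C1_close phi dphi psi dpsi (t - eps) (t + eps) delta ->
      exists z, t - eps < z < t + eps /\ psi z = 0 /\
        forall x, t - eps <= x <= t + eps -> psi x = 0 -> x = z.
Proof.
  intros Hd Hc H0 Hn. destruct (Rlt_dec 0 (dphi t)) as [H|H].
  - apply (increasing_zero_persists phi dphi); assumption.
  - destruct (increasing_zero_persists (fun x => - phi x) (fun x => - dphi x) t) as (r & Hr & Hex).
    + intros x. apply @is_derive_opp, Hd.
    + apply (continuous_opp dphi t Hc).
    + lra.
    + lra.
    + exists r. split; [ exact Hr | ]. intros eps Heps.
      destruct (Hex eps Heps) as (delta & Hdelta & Hex'). exists delta. split; [ exact Hdelta | ].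
      intros psi dpsi Hpsi Hclose.
      destruct (Hex' (fun x => - psi x) (fun x => - dpsi x)) as (z & Hz & Hz0 & Hu).
      * intros x. apply @is_derive_opp, Hpsi.
      * intros x Hx. destruct (Hclose x Hx) as [H1 H2].
        replace (- psi x - - phi x) with (- (psi x - phi x)) by ring.
        replace (- dpsi x - - dphi x) with (- (dpsi x - dphi x)) by ring.
        rewrite 2!Rabs_Ropp. split; assumption.
      * exists z. split; [ exact Hz | ]. split; [ lra | ]. intros x Hx Hx0. apply Hu; lra.
Qed.

Lemma chain_le (t : nat -> R) (i j : nat) :
  (i <= j)%nat -> (forall k, (i <= k < j)%nat -> t k < t (S k)) -> t i <= t j.
Proof.
  intros Hij. induction Hij as [|j Hij IH]; intros H; [ lra | ].
  specialize (IH ltac:(intros; apply H; lia)). specialize (H j ltac:(lia)). lra.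
Qed.

(** [t 0] is the left end of the window, not a zero. Induction on [n] adds a stretch where [|phi|]
    is bounded below and a small interval around the next simple zero; keeping [eps] below a third
    of the gap separates these. The zeros of [psi] in the window are listed completely, as the index
    of a critical point requires. *)
Lemma zeros_persist (phi dphi : R -> R) (t : nat -> R) (n : nat) :
  (forall x, is_derive phi x (dphi x)) -> (forall x, continuous dphi x) -> phi (t O) <> 0 ->
  (forall k, (k < n)%nat -> t k < t (S k)) ->
  (forall k, (1 <= k <= n)%nat -> phi (t k) = 0 /\ dphi (t k) <> 0) ->
  (forall x, t O <= x <= t n -> phi x = 0 -> exists k, (1 <= k <= n)%nat /\ x = t k) ->
  exists r, 0 < r /\ forall eps, 0 < eps <= r -> exists delta, 0 < delta /\
    forall psi dpsi, (forall x, is_derive psi x (dpsi x)) ->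
      C1_close phi dphi psi dpsi (t O) (t n + eps) delta ->
      exists z : nat -> R,
        (forall k, (1 <= k <= n)%nat -> t O < z k /\ psi (z k) = 0 /\ Rabs (z k - t k) < eps) /\
        (forall k, (1 <= k < n)%nat -> z k < z (S k)) /\
        (forall x, t O <= x <= t n + eps -> psi x = 0 -> exists k, (1 <= k <= n)%nat /\ x = z k).
Proof.
  intros Hd Hc H0.
  assert (Hphic : forall x, continuous phi x) by (intros x; apply (is_derive_continuous _ _ _ (Hd x))).
  induction n as [|n IH]; intros Ht Hz Hall.
  - pose proof (Hphic (t O)) as Hc0. apply continuity_pt_filterlim in Hc0.
    destruct (Hc0 (Rabs (phi (t O)) / 2)) as (d & Hd0 & Hcd).
    { apply Rabs_pos_lt in H0; lra. }
    pose proof (Rabs_pos_lt _ H0) as Hp0.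
    exists (d / 2). split; [ lra | ]. intros eps Heps. exists (Rabs (phi (t O)) / 4). split; [ lra | ].
    (* A dummy list: with [n = 0] no index is admissible, and [psi] has no zero in the short
       window. *)
    intros psi dpsi Hpsi Hclose. exists (fun _ => 0).
    split; [ intros; lia | ]. split; [ intros; lia | ]. intros x Hx Hx0. exfalso.
    destruct (Hclose x Hx) as [H1 _]. rewrite Hx0 in H1.
    assert (H2 : Rabs (phi x - phi (t O)) < Rabs (phi (t O)) / 2).
    { destruct (Req_dec x (t O)) as [->|Hn]; [ rewrite Rminus_diag, Rabs_R0; lra | ].
      specialize (Hcd x). simpl in Hcd. unfold Rdist in Hcd. apply Hcd.
      split; [ split; [ exact I | congruence ] | ]. rewrite Rabs_pos_eq; lra. }
    assert (H3 : Rabs (phi (t O)) <= Rabs (phi x - phi (t O)) + Rabs (0 - phi x)).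
    { rewrite <- (Rabs_Ropp (phi (t O))).
      replace (- phi (t O)) with ((phi x - phi (t O)) + (0 - phi x)) by ring. apply Rabs_triang. }
    lra.
  - pose proof (Ht n ltac:(lia)) as Hstep.
    pose proof (chain_le t 0 n ltac:(lia) ltac:(intros; apply Ht; lia)) as H0n.
    destruct IH as (r1 & Hr1 & IH).
    { intros; apply Ht; lia. }
    { intros; apply Hz; lia. }
    { intros x Hx Hx0. destruct (Hall x ltac:(lra) Hx0) as (k & Hk & ->).
      destruct (Nat.eq_dec k (S n)) as [->|Hk']; [ lra | ]. exists k; split; [ lia | reflexivity ]. }
    destruct (Hz (S n) ltac:(lia)) as [Hz1 Hz2].
    destruct (simple_zero_persists phi dphi (t (S n)) Hd (Hc _) Hz1 Hz2) as (r2 & Hr2 & Hsz).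
    set (gap := (t (S n) - t n) / 3).
    set (r := Rmin (Rmin r1 r2) gap).
    assert (Hr : 0 < r /\ r <= r1 /\ r <= r2 /\ r <= gap).
    { unfold r. split; [ unfold gap; repeat apply Rmin_pos; lra | ].
      pose proof (Rmin_l (Rmin r1 r2) gap). pose proof (Rmin_r (Rmin r1 r2) gap).
      pose proof (Rmin_l r1 r2). pose proof (Rmin_r r1 r2). lra. }
    clearbody r. unfold gap in Hr. exists r. split; [ lra | ]. intros eps Heps.
    destruct (IH eps ltac:(lra)) as (d1 & Hd1 & IH').
    destruct (Hsz eps ltac:(lra)) as (d2 & Hd2 & Hsz').
    destruct (nonvanishing_lower_bound phi (t n + eps) (t (S n) - eps) ltac:(lra) Hphic) as (mu & Hmu & Hlow).
    { intros x Hx Hx0. destruct (Hall x ltac:(lra) Hx0) as (k & Hk & ->).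
      destruct (Nat.eq_dec k (S n)) as [->|Hk']; [ lra | ].
      pose proof (chain_le t k n ltac:(lia) ltac:(intros; apply Ht; lia)). lra. }
    set (delta := Rmin (Rmin d1 d2) (mu / 2)).
    assert (Hdelta : 0 < delta /\ delta <= d1 /\ delta <= d2 /\ delta <= mu / 2).
    { unfold delta. split; [ repeat apply Rmin_pos; lra | ].
      pose proof (Rmin_l (Rmin d1 d2) (mu / 2)). pose proof (Rmin_r (Rmin d1 d2) (mu / 2)).
      pose proof (Rmin_l d1 d2). pose proof (Rmin_r d1 d2). lra. }
    clearbody delta. exists delta. split; [ lra | ]. intros psi dpsi Hpsi Hclose.
    destruct (IH' psi dpsi Hpsi) as (z & Z1 & Z2 & Z3).
    { intros x Hx. destruct (Hclose x ltac:(lra)). lra. }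
    destruct (Hsz' psi dpsi Hpsi) as (w & W1 & W2 & W3).
    { intros x Hx. destruct (Hclose x ltac:(lra)). lra. }
    exists (fun k => if Nat.eq_dec k (S n) then w else z k). split; [ | split ].
    + intros k Hk. destruct (Nat.eq_dec k (S n)) as [->|Hk'].
      * split; [ lra | ]. split; [ exact W2 | ]. apply Rabs_lt_between; lra.
      * apply Z1; lia.
    + intros k Hk. destruct (Nat.eq_dec k (S n)) as [|Hk']; [ lia | ].
      destruct (Nat.eq_dec (S k) (S n)) as [Hk''|Hk''].
      * assert (k = n) by lia. subst k. destruct (Z1 n ltac:(lia)) as (_ & _ & H).
        apply Rabs_lt_between in H. lra.
      * apply Z2; lia.
    + intros x Hx Hx0. destruct (Rle_dec x (t n + eps)) as [Hl|Hl].
      * destruct (Z3 x ltac:(lra) Hx0) as (k & Hk & Hxk). exists k. split; [ lia | ].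
        destruct (Nat.eq_dec k (S n)); [ lia | exact Hxk ].
      * destruct (Rle_dec x (t (S n) - eps)) as [Hl'|Hl'].
        -- exfalso. specialize (Hlow x ltac:(lra)). destruct (Hclose x ltac:(lra)) as [H _].
           rewrite Hx0, Rminus_0_l, Rabs_Ropp in H. lra.
        -- exists (S n). split; [ lia | ]. destruct (Nat.eq_dec (S n) (S n)); [ apply W3; [ lra | exact Hx0 ] | lia ].
Qed.

(** If [s < s'], every [c k] lies below [s'] and so occurs in the list [c']. As
    [c' k <= c k < c (S k)], it occurs there beyond position [k]; induction gives [c' k <= c k] for
    all [k], which is absurd at [n]. *)
Lemma nth_crit_ge (g : R -> R) (n : nat) (s s' : R) : (1 <= n)%nat ->
  is_nth_crit g n s -> is_nth_crit g n s' -> s' <= s.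
Proof.
  intros Hn (c & Hcn & Hc1 & Hc2 & _) (c' & Hcn' & Hc1' & Hc2' & Hc3').
  apply Rnot_lt_le; intros Hlt.
  assert (Hcs : forall k, (1 <= k <= n)%nat -> 0 < c k < s').
  { intros k Hk. destruct (Hc1 k Hk). split; [ assumption | ].
    pose proof (chain_le c k n ltac:(lia) ltac:(intros; apply Hc2; lia)). lra. }
  assert (H : forall k, (1 <= k <= n)%nat -> c' k <= c k).
  { intros k. induction k as [|k IH]; intros Hk; [ lia | ].
    destruct (Hc3' (c (S k)) (Hcs _ Hk) (proj2 (Hc1 _ Hk))) as (j & Hj & Heq).
    rewrite Heq. apply chain_le; [ | intros; apply Hc2'; lia ].
    destruct (Nat.eq_dec k 0) as [->|Hk0]; [ lia | ].
    specialize (IH ltac:(lia)). specialize (Hc2 k ltac:(lia)).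
    destruct (Nat.le_gt_cases j k) as [Hjk|Hjk]; [ | lia ].
    pose proof (chain_le c' j k Hjk ltac:(intros; apply Hc2'; lia)). lra. }
  specialize (H n ltac:(lia)). lra.
Qed.

Lemma nth_crit_unique (g : R -> R) (n : nat) (s s' : R) : (1 <= n)%nat ->
  is_nth_crit g n s -> is_nth_crit g n s' -> s = s'.
Proof.
  intros Hn H H'. apply Rle_antisym; eapply nth_crit_ge; eassumption.
Qed.

(** * Regular solutions *)

(* The radial equation in the variable [t = ln s / m], for [U t = u (exp (m t))]. *)
Definition log_radial (m d p : R) (U dU : R -> R) : Prop :=
  forall t, is_derive U t (dU t) /\
    is_derive dU t (- (m * (d - 2)) * dU t - m ^ 2 * exp (2 * m * t) * fN p (U t)).

Lemma ppow_scale (q k x : R) : 0 < k -> ppow q (k * x) = Rpower k q * ppow q x.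
Proof.
  intros Hk. destruct (Rlt_dec 0 x) as [H|H].
  - rewrite 2!ppow_pos by nra. symmetry; apply Rpower_mult_distr; assumption.
  - rewrite 2!ppow_nonpos by nra. ring.
Qed.

(** The relation for [a] matches the first-order terms, [c ^ 2 + a * c = 1] produces the term [y],
    and the last two relations normalize the coefficient of [y^p] to [1]. Note that [y' - c y] is
    [exp (c t) / A] times [U']. *)
Lemma emden_of_log_radial (a m d p c A : R) (U dU : R -> R) :
  1 < p -> 0 < A -> a = m * (d - 2) - 2 * c -> c ^ 2 + a * c = 1 -> c * (p - 1) = 2 * m ->
  m ^ 2 * Rpower A (p - 1) = 1 -> log_radial m d p U dU ->
  emden a m p (fun t => exp (c * t) / A * U t) (fun t => exp (c * t) / A * (c * U t + dU t)).
Proof.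
  intros Hp HA Ha Hca Hcp HmA HU t. destruct (HU t) as [H1 H2]. split.
  - auto_derive; [ eexists; eassumption | ].
    rewrite (is_derive_unique (fun x : R => U x) _ _ H1). field. lra.
  - evar_last.
    + auto_derive; [ repeat split; eexists; eassumption | reflexivity ].
    + rewrite (is_derive_unique (fun x : R => U x) _ _ H1), (is_derive_unique (fun x : R => dU x) _ _ H2).
      assert (HP : ppow p (exp (c * t) / A * U t) = m ^ 2 * exp (2 * m * t) * (exp (c * t) / A * ppow p (U t))).
      { pose proof (exp_pos (c * t)) as He.
        assert (Hk : 0 < exp (c * t) / A) by (apply Rdiv_lt_0_compat; lra).
        rewrite ppow_scale by exact Hk.
        replace p with (1 + (p - 1)) at 1 by ring. rewrite Rpower_plus, Rpower_1 by exact Hk.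
        replace (Rpower (exp (c * t) / A) (p - 1)) with (m ^ 2 * exp (2 * m * t)); [ ring | ].
        apply Rmult_eq_reg_r with (Rpower A (p - 1)); [ | apply Rgt_not_eq, exp_pos ].
        rewrite Rpower_mult_distr by assumption.
        replace (exp (c * t) / A * A) with (exp (c * t)) by (field; lra).
        unfold Rpower at 2. rewrite ln_exp.
        replace ((p - 1) * (c * t)) with (2 * m * t) by (rewrite <- Hcp; ring).
        rewrite Rmult_assoc, (Rmult_comm (exp _)), <- Rmult_assoc, HmA. ring. }
      rewrite HP. unfold fN. rewrite Ha.
      rewrite Ha in Hca. apply Rminus_diag_uniq. unfold Rdiv.
      match goal with |- ?l = 0 => replace l with
        (((c ^ 2 + (m * (d - 2) - 2 * c) * c) - 1) * (exp (c * t) * / A * U t)) by ring end.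
      rewrite Hca. ring.
Qed.

(** In radial terms [u' = O(s)] at the origin: the flux [Z], a multiple of [s^(d-1) u'], has
    derivative of order [exp (m d x)], which is integrable at [-oo]. *)
Lemma log_radial_derivative_bound (m d p g : R) (U dU : R -> R) :
  0 < m -> 3 <= d -> 1 < p -> log_radial m d p U dU -> is_lim U m_infty g ->
  exists T M, forall t, t <= T -> Rabs (dU t) <= M * exp (2 * m * t).
Proof.
  intros Hm Hd Hp HU Hlim.
  destruct (is_lim_minf_eventually U g 1 Hlim ltac:(lra)) as (T & HT).
  set (B := Rabs g + 1 + ppow p (Rabs g + 1)).
  assert (HB : forall t, t < T -> Rabs (fN p (U t)) <= B).
  { intros t Ht. specialize (HT t Ht). pose proof (Rle_abs g). pose proof (Rabs_maj2 g).
    apply Rabs_lt_between in HT. unfold fN, B.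
    apply Rle_trans with (1 := Rabs_triang _ _). rewrite Rabs_Ropp.
    apply Rplus_le_compat; [ apply Rabs_le_between; lra | ].
    rewrite Rabs_pos_eq by apply ppow_ge0. apply ppow_le; lra. }
  exists (T - 1), (m * B / d). intros t Ht.
  set (Z := fun x => exp (m * (d - 2) * x) * dU x).
  assert (HZ : forall x, is_derive Z x (- m ^ 2 * exp (m * d * x) * fN p (U x))).
  { intros x. destruct (HU x) as [_ H2]. unfold Z. auto_derive; [ eexists; eassumption | ].
    rewrite (is_derive_unique (fun x : R => dU x) _ _ H2).
    replace (m * d * x) with (m * (d - 2) * x + 2 * m * x) by ring. rewrite exp_plus. ring. }
  assert (HW : forall x, is_derive (fun x => m * B / d * exp (m * d * x)) x (m ^ 2 * B * exp (m * d * x))).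
  { intros x. auto_derive; [ exact I | field; lra ]. }
  assert (Hsgn : forall x, x <= t -> - (m ^ 2 * B * exp (m * d * x)) <= - m ^ 2 * exp (m * d * x) * fN p (U x)
     <= m ^ 2 * B * exp (m * d * x)).
  { intros x Hx. specialize (HB x ltac:(lra)). apply Rabs_le_between in HB.
    pose proof (exp_pos (m * d * x)). pose proof (pow_lt m 2 Hm).
    assert (0 < m ^ 2 * exp (m * d * x)) by nra. split; nra. }
  (* That [Z] vanishes at [-oo] is not known yet. Convergence of [U] and the mean value theorem give
     points far to the left where [Z] is at most [e], and [e] is arbitrary. *)
  assert (HZb : forall e, 0 < e -> Rabs (Z t) <= m * B / d * exp (m * d * t) + e).
  { intros e He.
    destruct (is_lim_minf_eventually U g (e / 2) Hlim ltac:(lra)) as (T' & HT').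
    set (s := Rmin (Rmin T' t) 0 - 1).
    assert (Hs : s < T' /\ s < t /\ s < 0).
    { unfold s. pose proof (Rmin_l (Rmin T' t) 0). pose proof (Rmin_r (Rmin T' t) 0).
      pose proof (Rmin_l T' t). pose proof (Rmin_r T' t). lra. }
    destruct (mvt U dU (s - 1) s ltac:(lra) ltac:(intros; apply HU)) as (xi & Hxi & Hxi').
    pose proof (HT' s ltac:(lra)) as E1. pose proof (HT' (s - 1) ltac:(lra)) as E2.
    apply Rabs_lt_between in E1. apply Rabs_lt_between in E2.
    assert (HZxi : Rabs (Z xi) <= e).
    { unfold Z. rewrite Rabs_mult, (Rabs_pos_eq (exp _)) by (left; apply exp_pos).
      assert (Rabs (dU xi) <= e) by (apply Rabs_le_between; lra).
      assert (exp (m * (d - 2) * xi) <= 1).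
      { rewrite <- exp_0. apply exp_le_of.
        assert (0 < m * (d - 2)) by (apply Rmult_lt_0_compat; lra). nra. }
      pose proof (exp_pos (m * (d - 2) * xi)). pose proof (Rabs_pos (dU xi)). nra. }
    apply Rabs_le_between in HZxi.
    assert (HW0 : 0 <= m * B / d * exp (m * d * xi)).
    { apply Rmult_le_pos; [ | left; apply exp_pos ]. apply Rdiv_le_0_compat; [ | lra ].
      apply Rmult_le_pos; [ lra | ]. unfold B. pose proof (Rabs_pos g).
      pose proof (ppow_ge0 p (Rabs g + 1)). lra. }
    assert (Z t - m * B / d * exp (m * d * t) <= Z xi - m * B / d * exp (m * d * xi)).
    { apply (antitone (fun x => Z x - m * B / d * exp (m * d * x))
        (fun x => - m ^ 2 * exp (m * d * x) * fN p (U x) - m ^ 2 * B * exp (m * d * x))); [ lra | | ].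
      - intros x _. apply @is_derive_minus; [ apply HZ | apply HW ].
      - intros x Hx. specialize (Hsgn x ltac:(lra)). lra. }
    assert (- Z t - m * B / d * exp (m * d * t) <= - Z xi - m * B / d * exp (m * d * xi)).
    { apply (antitone (fun x => - Z x - m * B / d * exp (m * d * x))
        (fun x => - (- m ^ 2 * exp (m * d * x) * fN p (U x)) - m ^ 2 * B * exp (m * d * x))); [ lra | | ].
      - intros x _. apply @is_derive_minus; [ apply @is_derive_opp, HZ | apply HW ].
      - intros x Hx. specialize (Hsgn x ltac:(lra)). lra. }
    apply Rabs_le_between. lra. }
  apply le_epsilon in HZb. unfold Z in HZb.
  rewrite Rabs_mult, (Rabs_pos_eq (exp _)) in HZb by (left; apply exp_pos).
  replace (m * d * t) with (m * (d - 2) * t + 2 * m * t) in HZb by ring. rewrite exp_plus in HZb.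
  apply Rmult_le_reg_l with (exp (m * (d - 2) * t)); [ apply exp_pos | ]. lra.
Qed.

(** Three weights matter: [k = m (d - 2)] for the flux, [k = c] for [y'], and the negative
    [k = - m], which recovers [u'] itself up to the factor [m]. *)
Lemma log_radial_derivative_lim (m d p g k : R) (U dU : R -> R) :
  0 < m -> 3 <= d -> 1 < p -> log_radial m d p U dU -> is_lim U m_infty g -> 0 < k + 2 * m ->
  is_lim (fun t => exp (k * t) * dU t) m_infty 0.
Proof.
  intros Hm Hd Hp HU Hlim Hk.
  destruct (log_radial_derivative_bound m d p g U dU Hm Hd Hp HU Hlim) as (T & M & HM).
  assert (HE : forall C : R, is_lim (fun t => C * exp ((k + 2 * m) * t)) m_infty 0).
  { intros C. rewrite <- (Rmult_0_r C). apply is_lim_mult'; [ apply is_lim_const | apply is_lim_exp_scal, Hk ]. }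
  apply (is_lim_le_le_loc (fun t => - M * exp ((k + 2 * m) * t)) (fun t => M * exp ((k + 2 * m) * t)));
    [ | apply HE | apply HE ].
  exists T. intros t Ht. specialize (HM t ltac:(lra)). apply Rabs_le_between in HM.
  replace ((k + 2 * m) * t) with (k * t + 2 * m * t) by ring. rewrite exp_plus.
  pose proof (exp_pos (k * t)). split; nra.
Qed.

Lemma flux_is_derive (m d p : R) (U dU : R -> R) (x : R) : log_radial m d p U dU ->
  is_derive (fun x => exp (m * (d - 2) * x) * dU x) x (- m ^ 2 * exp (m * d * x) * fN p (U x)).
Proof.
  intros HU. destruct (HU x) as [_ H2]. auto_derive; [ eexists; eassumption | ].
  rewrite (is_derive_unique (fun x : R => dU x) _ _ H2).
  replace (m * d * x) with (m * (d - 2) * x + 2 * m * x) by ring. rewrite exp_plus. ring.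
Qed.

Lemma flux_lim (m d p g : R) (U dU : R -> R) :
  0 < m -> 3 <= d -> 1 < p -> log_radial m d p U dU -> is_lim U m_infty g ->
  is_lim (fun x => exp (m * (d - 2) * x) * dU x) m_infty 0.
Proof.
  intros Hm Hd Hp HU Hlim. apply (log_radial_derivative_lim m d p g _ U); try assumption.
  assert (0 < m * (d - 2)) by (apply Rmult_lt_0_compat; lra). lra.
Qed.

Lemma log_radial_decreasing_while_gt_1 (m d p g T0 t : R) (U dU : R -> R) :
  0 < m -> 3 <= d -> 1 < p -> log_radial m d p U dU -> is_lim U m_infty g ->
  (forall x, x <= T0 -> 1 < U x) -> t <= T0 -> dU t < 0.
Proof.
  intros Hm Hd Hp HU Hlim H Ht. pose proof (pow_lt m 2 Hm) as Hm2.
  set (Z := fun x => exp (m * (d - 2) * x) * dU x).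
  assert (Hneg : forall x, x <= T0 -> - m ^ 2 * exp (m * d * x) * fN p (U x) < 0).
  { intros x Hx. pose proof (potential_deriv_pos p (U x) Hp (H x Hx)). pose proof (exp_pos (m * d * x)).
    assert (0 < m ^ 2 * exp (m * d * x)) by (apply Rmult_lt_0_compat; lra).
    unfold fN. clear - H0 H2. nra. }
  assert (Z t < 0).
  (* Comparison with the limit yields only a weak inequality; the unit step from [t - 1] to [t]
     makes it strict. *)
  { apply Rlt_le_trans with (Z (t - 1)).
    - apply (strictly_antitone Z (fun x => - m ^ 2 * exp (m * d * x) * fN p (U x))); [ lra | | ].
      + intros; apply flux_is_derive, HU.
      + intros; apply Hneg; lra.
    - apply (antitone_le_lim Z (fun x => - m ^ 2 * exp (m * d * x) * fN p (U x))); [ | | apply (flux_lim m d p g U); assumption ].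
      + intros; apply flux_is_derive, HU.
      + intros; left; apply Hneg; lra. }
  apply Rmult_lt_reg_l with (exp (m * (d - 2) * t)); [ apply exp_pos | ].
  rewrite Rmult_0_r. assumption.
Qed.

Ltac is_lim_auto :=
  lazymatch goal with
  | H : is_lim ?f _ _ |- is_lim ?f _ _ => exact H
  | |- is_lim (fun _ => ?k) _ _ => apply is_lim_const
  | |- is_lim (fun t => _ + _) _ _ => apply is_lim_plus'; is_lim_auto
  | |- is_lim (fun t => _ * _) _ _ => apply is_lim_mult'; is_lim_auto
  end.

Lemma energy_lim_0 (m p : R) (y dy : R -> R) : 0 < m -> 1 < p ->
  is_lim y m_infty 0 -> is_lim dy m_infty 0 -> is_lim (energy m p y dy) m_infty 0.
Proof.
  intros Hm Hp Hy Hdy.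
  assert (Hpp : is_lim (fun t => ppow p (y t)) m_infty 0).
  { rewrite <- (ppow_nonpos p 0) at 1 by lra. apply is_lim_comp_continuous; [ exact Hy | ].
    apply ppow_continuous; lra. }
  pose proof (is_lim_exp_scal (2 * m) ltac:(lra)) as He.
  apply (is_lim_ext (fun t => dy t * dy t * / 2 + - / 2 * (y t * y t) + y t * ppow p (y t) * / (p + 1)
    + - (m ^ 2 / 2) * (exp (2 * m * t) * (y t * y t)))).
  { intros t. unfold energy. field. lra. }
  replace 0 with (0 * 0 * / 2 + - / 2 * (0 * 0) + 0 * 0 * / (p + 1) + - (m ^ 2 / 2) * (0 * (0 * 0))) by ring.
  is_lim_auto.
Qed.

(** * A priori bounds for regular solutions *)

Section RegularSolution.

Context (a m d p c A g : R) (U dU : R -> R).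
Context (Hp : 1 < p) (Ha0 : 0 < a) (Hm : 0 < m) (Hd : 3 <= d) (Hc : 0 < c) (HA : 0 < A).
Context (Ha : a = m * (d - 2) - 2 * c) (Hca : c ^ 2 + a * c = 1) (Hcp : c * (p - 1) = 2 * m).
Context (HmA : m ^ 2 * Rpower A (p - 1) = 1).
Context (HU : log_radial m d p U dU) (Hlim : is_lim U m_infty g) (Hg : 1 < g).

Let y := fun t => exp (c * t) / A * U t.
Let dy := fun t => exp (c * t) / A * (c * U t + dU t).

Lemma regular_emden : emden a m p y dy.
Proof. apply (emden_of_log_radial a m d p c A); assumption. Qed.

(** The orbit leaves the saddle [(0, 0)], whose energy is [0]: [y] and [y'] carry the factor
    [exp (c t)], while [U] stays bounded and [exp (c t) U'] tends to [0]. *)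
Lemma regular_energy_lim : is_lim (energy m p y dy) m_infty 0.
Proof.
  pose proof (is_lim_exp_scal c Hc) as He.
  pose proof (log_radial_derivative_lim m d p g c U dU Hm Hd Hp HU Hlim ltac:(lra)) as Hl.
  apply energy_lim_0; [ exact Hm | exact Hp | | ].
  - apply (is_lim_ext (fun t => exp (c * t) * U t * / A)); [ intros; unfold y; field; lra | ].
    replace 0 with (0 * g * / A) by ring.
    is_lim_auto.
  - apply (is_lim_ext (fun t => exp (c * t) * U t * (c / A) + exp (c * t) * dU t * / A)).
    { intros; unfold dy; field; lra. }
    replace 0 with (0 * g * (c / A) + 0 * / A) by ring.
    is_lim_auto.
Qed.

Lemma regular_energy_nonpos (t : R) : energy m p y dy t <= 0.
Proof.
  apply (antitone_le_lim _ (fun t => - a * dy t ^ 2 - m ^ 3 * exp (2 * m * t) * y t ^ 2));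
    [ | | apply regular_energy_lim ].
  - intros x _. apply (energy_is_derive a); [ exact Hp | apply regular_emden ].
  - intros x _. pose proof (pow2_ge_0 (dy x)). pose proof (pow2_ge_0 (y x)).
    assert (0 <= m ^ 3 * exp (2 * m * x)).
    { left; apply Rmult_lt_0_compat; [ apply pow_lt, Hm | apply exp_pos ]. } nra.
Qed.

Lemma regular_pos_near_minf : exists T, forall t, t < T -> 0 < U t.
Proof.
  destruct (is_lim_minf_eventually U g 1 Hlim ltac:(lra)) as (T & HT).
  exists T. intros t Ht. specialize (HT t Ht). apply Rabs_lt_between in HT. lra.
Qed.

Lemma regular_y_pos_iff (t : R) : 0 < y t <-> 0 < U t.
Proof.
  unfold y. assert (0 < exp (c * t) / A) by (apply Rdiv_lt_0_compat; [ apply exp_pos | exact HA ]).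
  split; nra.
Qed.

(** Near [-oo], where [U] is known to be positive, the forcing dissipation [m^3 exp (2 m t) y^2] is
    strict. Strictness is what the positivity argument needs. *)
Lemma regular_energy_neg (t : R) : energy m p y dy t < 0.
Proof.
  destruct regular_pos_near_minf as (T & HT).
  set (s := Rmin T t - 1).
  assert (Hs : s < T /\ s <= t).
  { unfold s. pose proof (Rmin_l T t). pose proof (Rmin_r T t). lra. }
  apply Rle_lt_trans with (energy m p y dy s).
  { apply (energy_antitone a); try assumption; [ apply regular_emden | lra ]. }
  apply Rlt_le_trans with (2 := regular_energy_nonpos (s - 1)).
  apply (strictly_antitone _ (fun t => - a * dy t ^ 2 - m ^ 3 * exp (2 * m * t) * y t ^ 2)); [ lra | | ].
  - intros x _. apply (energy_is_derive a); [ exact Hp | apply regular_emden ].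
  - intros x Hx. pose proof (pow2_ge_0 (dy x)).
    assert (Hy : 0 < y x) by (apply regular_y_pos_iff, HT; lra). pose proof (pow_lt _ 2 Hy).
    assert (0 < m ^ 3 * exp (2 * m * x)).
    { apply Rmult_lt_0_compat; [ apply pow_lt, Hm | apply exp_pos ]. } nra.
Qed.

(** At a zero of [y] the energy is [y'^2 / 2 >= 0], contradicting its strict negativity. *)
Lemma regular_pos (t : R) : 0 < U t.
Proof.
  apply regular_y_pos_iff. apply Rnot_le_lt; intros Hle.
  destruct regular_pos_near_minf as (T & HT).
  set (s := Rmin T t - 1).
  assert (Hs : s < T /\ s <= t).
  { unfold s. pose proof (Rmin_l T t). pose proof (Rmin_r T t). lra. }
  assert (Hy : 0 < y s) by (apply regular_y_pos_iff, HT; lra).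
  destruct (IVT_gen y s t 0) as (z & _ & Hz).
  - intros x. apply continuity_pt_filterlim. apply (is_derive_continuous _ _ _ (proj1 (regular_emden x))).
  - rewrite Rmin_right, Rmax_left; lra.
  - pose proof (regular_energy_neg z) as H. unfold energy in H. rewrite Hz in H.
    pose proof (pow2_ge_0 (dy z)). unfold Rdiv in H. rewrite pow_i in H by lia. lra.
Qed.

(** Uses the energy of the radial equation itself: [h] is [u'^2 / 2 + F(u)] with [F' = f], it
    decreases from [F(g)], and [F] increases on [u >= 1]. *)
Lemma regular_le_start (t : R) : U t <= g.
Proof.
  apply Rnot_lt_le; intros Hlt.
  pose proof (potential_increasing p g (U t) Hp ltac:(lra) Hlt) as Hpot.
  set (h := fun t => (exp (- m * t) * dU t) ^ 2 / (2 * m ^ 2) + potential p (U t)).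
  pose proof (pow_lt m 2 Hm) as Hm2.
  assert (h t <= potential p g).
  { apply (antitone_le_lim h (fun t => - (d - 1) / m * (exp (- m * t) * dU t) ^ 2)).
    - intros x _. destruct (HU x) as [H1 H2].
      evar_last.
      + apply @is_derive_plus.
        * auto_derive; [ eexists; eassumption | reflexivity ].
        * apply (is_derive_comp (potential p) U); [ apply potential_is_derive, Hp | exact H1 ].
      + rewrite (is_derive_unique (fun x : R => dU x) _ _ H2). unfold plus, scal, mult, fN; simpl. unfold mult; simpl.
        replace (2 * m * x) with (- (- m * x) + - (- m * x)) by ring.
        rewrite exp_plus, exp_Ropp. pose proof (exp_pos (- m * x)). field. lra.
    - intros x _. pose proof (pow2_ge_0 (exp (- m * x) * dU x)).
      assert (0 <= (d - 1) / m) by (apply Rdiv_le_0_compat; lra). unfold Rdiv in *. nra.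
    - pose proof (log_radial_derivative_lim m d p g (- m) U dU Hm Hd Hp HU Hlim ltac:(lra)) as Hl.
      apply (is_lim_ext (fun t => (exp (- m * t) * dU t) * (exp (- m * t) * dU t) * / (2 * m ^ 2)
         + potential p (U t))); [ intros; unfold h; field; lra | ].
      replace (potential p g) with (0 * 0 * / (2 * m ^ 2) + potential p g) by ring.
      apply is_lim_plus'.
      + apply is_lim_mult'; [ apply is_lim_mult'; exact Hl | apply is_lim_const ].
      + apply is_lim_comp_continuous; [ exact Hlim | ].
        apply (is_derive_continuous _ _ _ (potential_is_derive p g Hp)). }
  assert (0 <= (exp (- m * t) * dU t) ^ 2 / (2 * m ^ 2)).
  { apply Rdiv_le_0_compat; [ apply pow2_ge_0 | lra ]. }
  unfold h in H. lra.
Qed.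

(** Integration of the flux with [f(U) <= U^p <= g^p]; in the radial variable, [u' >= - g^p s / d].
    The explicit power of [g] is what later scales out. *)
Lemma regular_derivative_ge (t : R) : - (m / d * ppow p g * exp (2 * m * t)) <= dU t.
Proof.
  pose proof (pow_lt m 2 Hm) as Hm2.
  assert (H : - (exp (m * (d - 2) * t) * dU t) + - (m / d * ppow p g) * exp (m * d * t) <= 0).
  { apply (antitone_le_lim (fun t => - (exp (m * (d - 2) * t) * dU t) + - (m / d * ppow p g) * exp (m * d * t))
     (fun t => m ^ 2 * exp (m * d * t) * fN p (U t) + - (m / d * ppow p g) * (m * d * exp (m * d * t)))).
    - intros x _. apply @is_derive_plus.
      + evar_last; [ apply @is_derive_opp, (flux_is_derive m d p U), HU | unfold opp; simpl; ring ].
      + auto_derive; [ exact I | ring ].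
    - intros x _. replace (- (m / d * ppow p g) * (m * d * exp (m * d * x)))
        with (- (m ^ 2 * exp (m * d * x) * ppow p g)) by (field; lra).
      assert (fN p (U x) <= ppow p g).
      { unfold fN. pose proof (ppow_le p (U x) g ltac:(lra) (regular_le_start x)).
        pose proof (regular_pos x). lra. }
      assert (0 < m ^ 2 * exp (m * d * x)) by (apply Rmult_lt_0_compat; [ lra | apply exp_pos ]). nra.
    - replace (Finite 0) with (Finite (- 0 + - (m / d * ppow p g) * 0)) by (f_equal; ring).
      apply is_lim_plus'.
      + apply (is_lim_opp _ _ (Finite 0)), (flux_lim m d p g U); assumption.
      + apply is_lim_mult'; [ apply is_lim_const | apply is_lim_exp_scal; nra ]. }
  replace (m * d * t) with (m * (d - 2) * t + 2 * m * t) in H by ring. rewrite exp_plus in H.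
  apply Rmult_le_reg_l with (exp (m * (d - 2) * t)); [ apply exp_pos | ]. lra.
Qed.

Lemma regular_ge (t : R) : g - ppow p g * exp (2 * m * t) / (2 * d) <= U t.
Proof.
  assert (H : - U t + - (ppow p g / (2 * d)) * exp (2 * m * t) <= - g).
  { apply (antitone_le_lim (fun t => - U t + - (ppow p g / (2 * d)) * exp (2 * m * t))
     (fun t => - dU t + - (ppow p g / (2 * d)) * (2 * m * exp (2 * m * t)))).
    - intros x _. apply @is_derive_plus; [ apply @is_derive_opp, HU | ].
      auto_derive; [ exact I | ring ].
    - intros x _. pose proof (regular_derivative_ge x).
      replace (- (ppow p g / (2 * d)) * (2 * m * exp (2 * m * x)))
        with (- (m / d * ppow p g * exp (2 * m * x))) by (field; lra). lra.
    - replace (Finite (- g)) with (Finite (- g + - (ppow p g / (2 * d)) * 0)) by (f_equal; ring).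
      apply is_lim_plus'.
      + apply (is_lim_opp _ _ (Finite g)), Hlim.
      + apply is_lim_mult'; [ apply is_lim_const | apply is_lim_exp_scal; lra ]. }
  replace (ppow p g * exp (2 * m * t) / (2 * d)) with (ppow p g / (2 * d) * exp (2 * m * t)) by (field; lra).
  lra.
Qed.

End RegularSolution.

(* Rescaled time [tau = t + ln g / c] turns the start of every regular solution into the same profile
   on [tau <= tau0], where [U >= g / 2] and [y' >= b > 0] on a unit interval. *)
Lemma regular_energy_gap (a m d p c A : R) :
  1 < p -> 0 < a -> 0 < m -> 3 <= d -> 0 < c -> 0 < A ->
  a = m * (d - 2) - 2 * c -> c ^ 2 + a * c = 1 -> c * (p - 1) = 2 * m -> m ^ 2 * Rpower A (p - 1) = 1 ->
  exists tau0 eta, 0 < eta /\ forall (g : R) U dU, log_radial m d p U dU -> is_lim U m_infty g -> 1 < g ->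
    energy m p (fun t => exp (c * t) / A * U t) (fun t => exp (c * t) / A * (c * U t + dU t))
      (tau0 - ln g / c) <= - eta /\
    forall t, t <= tau0 - ln g / c -> g / 2 <= U t.
Proof.
  intros Hp Ha0 Hm Hd Hc HA Ha Hca Hcp HmA.
  (* The bound [d] yields [U >= g / 2], the other one [U' >= - c g / 4]; together
     [c U + U' >= c g / 4]. *)
  destruct (exp_eventually_le (2 * m) (Rmin d (c * d / (4 * m))) ltac:(lra)) as (tau0 & Htau0).
  { apply Rmin_pos; [ lra | ]. apply Rdiv_lt_0_compat; nra. }
  assert (Hexp : forall tau, tau <= tau0 -> exp (2 * m * tau) <= d /\ m / d * exp (2 * m * tau) <= c / 4).
  { intros tau Ht. specialize (Htau0 tau Ht).
    pose proof (Rmin_l d (c * d / (4 * m))). pose proof (Rmin_r d (c * d / (4 * m))).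
    split; [ lra | ]. replace (c / 4) with (m / d * (c * d / (4 * m))) by (field; lra).
    apply Rmult_le_compat_l; [ left; apply Rdiv_lt_0_compat; lra | lra ]. }
  set (b := exp (c * (tau0 - 1)) / A * (c / 4)).
  assert (Hb : 0 < b) by (apply Rmult_lt_0_compat; [ apply Rdiv_lt_0_compat; [ apply exp_pos | exact HA ] | lra ]).
  exists tau0, (a * b ^ 2). pose proof (pow_lt b 2 Hb) as Hb2. split; [ nra | ].
  intros g U dU HU Hlim Hg.
  assert (HUge : forall tau, tau <= tau0 -> g / 2 <= U (tau - ln g / c) /\
     - (c / 4 * g) <= dU (tau - ln g / c)).
  { intros tau Ht. destruct (Hexp tau Ht) as [E1 E2].
    (* Since [2 m / c = p - 1], the shift by [ln g / c] divides [g^p] by [g^(p-1)], and all bounds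
       become linear in [g]. *)
    assert (Hgp : ppow p g * exp (2 * m * (tau - ln g / c)) = g * exp (2 * m * tau)).
    { rewrite ppow_pos by lra. unfold Rpower.
      replace (g * exp (2 * m * tau)) with (exp (ln g) * exp (2 * m * tau)) by (rewrite exp_ln by lra; ring).
      rewrite <- 2!exp_plus. f_equal. rewrite <- Hcp. field. lra. }
    pose proof (regular_ge a m d p c A g U dU Hp Ha0 Hm Hd Hc HA Ha Hca Hcp HmA HU Hlim Hg (tau - ln g / c)) as G1.
    pose proof (regular_derivative_ge a m d p c A g U dU Hp Ha0 Hm Hd Hc HA Ha Hca Hcp HmA HU Hlim Hg (tau - ln g / c)) as G2.
    rewrite Hgp in G1. rewrite Rmult_assoc, Hgp in G2. split.
    - apply Rle_trans with (2 := G1). replace (g * exp (2 * m * tau) / (2 * d)) with (g / (2 * d) * exp (2 * m * tau)) by (field; lra).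
      assert (g / (2 * d) * exp (2 * m * tau) <= g / (2 * d) * d).
      { apply Rmult_le_compat_l; [ left; apply Rdiv_lt_0_compat; lra | lra ]. }
      replace (g / (2 * d) * d) with (g / 2) in H by (field; lra). lra.
    - apply Rle_trans with (2 := G2). apply Ropp_le_contravar.
      replace (m / d * (g * exp (2 * m * tau))) with (m / d * exp (2 * m * tau) * g) by ring.
      apply Rmult_le_compat_r; lra. }
  split.
  2:{ intros t Ht. replace t with ((t + ln g / c) - ln g / c) by ring. apply HUge. lra. }
  set (y := fun t => exp (c * t) / A * U t). set (dy := fun t => exp (c * t) / A * (c * U t + dU t)).
  set (t1 := tau0 - ln g / c).
  assert (Hy : emden a m p y dy) by (apply (emden_of_log_radial a m d p c A); assumption).
  destruct (mvt (energy m p y dy) (fun t => - a * dy t ^ 2 - m ^ 3 * exp (2 * m * t) * y t ^ 2) (t1 - 1) t1)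
    as (x & Hx & Hx'); [ lra | intros; apply (energy_is_derive a); assumption | ].
  pose proof (regular_energy_nonpos a m d p c A g U dU Hp Ha0 Hm Hd Hc HA Ha Hca Hcp HmA HU Hlim (t1 - 1)) as H0.
  fold y dy in H0.
  assert (b <= dy x).
  { destruct (HUge (x + ln g / c)) as [G1 G2]; [ unfold t1 in Hx'; lra | ].
    replace (x + ln g / c - ln g / c) with x in G1, G2 by ring.
    unfold dy. apply Rle_trans with (exp (c * x) / A * (c / 4 * g)).
    - unfold b. replace (exp (c * x) / A * (c / 4 * g)) with (exp (c * x) * g / A * (c / 4)) by (field; lra).
      apply Rmult_le_compat_r; [ lra | ]. apply Rmult_le_compat_r; [ left; apply Rinv_0_lt_compat, HA | ].
      rewrite <- (exp_ln g) at 1 by lra. rewrite <- exp_plus. apply exp_le_of.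
      replace (c * x + ln g) with (c * (x + ln g / c)) by (field; lra).
      apply Rmult_le_compat_l; [ lra | ]. unfold t1 in Hx'. lra.
    - apply Rmult_le_compat_l; [ left; apply Rdiv_lt_0_compat; [ apply exp_pos | exact HA ] | ]. nra. }
  assert (b ^ 2 <= dy x ^ 2) by (apply pow_incr; lra).
  assert (0 <= m ^ 3 * exp (2 * m * x) * y x ^ 2).
  { apply Rmult_le_pos; [ | apply pow2_ge_0 ]. left; apply Rmult_lt_0_compat; [ apply pow_lt, Hm | apply exp_pos ]. }
  nra.
Qed.

(** * Convergence *)

(* The derivative of [y' - c y] along a solution. *)
Definition critical_slope (a c m p : R) (y dy : R -> R) (t : R) : R :=
  - a * dy t + y t - ppow p (y t) + m ^ 2 * exp (2 * m * t) * y t - c * dy t.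

Lemma critical_slope_continuous (a c m p : R) (y dy : R -> R) (t : R) :
  1 < p -> emden a m p y dy -> continuous (critical_slope a c m p y dy) t.
Proof.
  intros Hp Hy. destruct (Hy t) as [H1 H2]. unfold critical_slope. apply @ex_derive_continuous. auto_derive.
  repeat split; try (eexists; eassumption). eexists; apply ppow_is_derive, Hp.
Qed.

(** [T0] is fixed before [T2], [delta] and [G]: left of it neither solution has a critical point,
    and right of it a compact interval remains. Closeness is stated for [y' - c y] and its
    derivative, the form that zero persistence consumes. *)
Lemma regular_solutions_converge (a m d p c A : R) (ys dys : R -> R) :
  1 < p -> 0 < a -> 0 < m -> 3 <= d -> 0 < c -> 0 < A ->
  a = m * (d - 2) - 2 * c -> c ^ 2 + a * c = 1 -> c * (p - 1) = 2 * m -> m ^ 2 * Rpower A (p - 1) = 1 ->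
  emden a m p ys dys -> (forall e, 0 < e -> exists T, forall t, t < T -> Rabs (ys t - 1) < e) ->
  exists T0, (forall t, t <= T0 -> dys t - c * ys t < 0) /\
    forall T2 delta, T0 <= T2 -> 0 < delta -> exists G, forall (g : R) U dU, G < g -> 1 < g ->
      log_radial m d p U dU -> is_lim U m_infty g ->
      let y := fun t => exp (c * t) / A * U t in
      let dy := fun t => exp (c * t) / A * (c * U t + dU t) in
      (forall t, t <= T0 -> dU t < 0) /\
      C1_close (fun t => dys t - c * ys t) (critical_slope a c m p ys dys)
        (fun t => dy t - c * y t) (critical_slope a c m p y dy) T0 T2 delta.
Proof.
  intros Hp Ha0 Hm Hd Hc HA Ha Hca Hcp HmA Hys Hlims.
  pose proof (pow_lt m 2 Hm) as Hm2.
  destruct (regular_energy_gap a m d p c A Hp Ha0 Hm Hd Hc HA Ha Hca Hcp HmA) as (tau0 & eta & Heta & Hgap).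
  destruct (exp_eventually_le (2 * m) (/ m ^ 2) ltac:(lra) ltac:(apply Rinv_0_lt_compat; lra)) as (Ta & HTa).
  assert (HTa1 : forall t, t <= Ta -> m ^ 2 * exp (2 * m * t) <= 1).
  { intros t Ht. specialize (HTa t Ht). apply (Rmult_le_compat_l (m ^ 2)) in HTa; [ | lra ].
    rewrite Rinv_r in HTa; lra. }
  destruct (emden_contraction a m p Hp Ha0 Hm) as (rho & cc & C & Tc & Hrho & Hcc & HC & Hcontr).
  destruct (emden_trapping a m p eta Ta rho Hp Ha0 Hm Heta (HTa1 Ta ltac:(lra)) Hrho)
    as (Tt & K & HTt & HK & Htrap).
  (* The last two bounds give [ys' - c ys <= c / 4 - c / 2 < 0] left of [T0]. *)
  set (e := Rmin rho (Rmin (1 / 2) (c / 4))).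
  assert (He : 0 < e /\ e <= rho /\ e <= 1 / 2 /\ e <= c / 4).
  { unfold e. split; [ repeat apply Rmin_pos; lra | ].
    pose proof (Rmin_l rho (Rmin (1 / 2) (c / 4))). pose proof (Rmin_r rho (Rmin (1 / 2) (c / 4))).
    pose proof (Rmin_l (1 / 2) (c / 4)). pose proof (Rmin_r (1 / 2) (c / 4)). lra. }
  clearbody e.
  destruct (emden_near_equilibrium a m p e ys dys Hp Ha0 Hm Hys Hlims ltac:(lra)) as (Ts & HTs).
  assert (Hse : 0 < sqrt eta) by (apply sqrt_lt_R0, Heta).
  destruct (exp_eventually_le c (A * sqrt eta / 2) Hc ltac:(nra)) as (Tb & HTb).
  set (T0 := Rmin (Rmin Tt Tc) (Rmin Ts Tb)).
  assert (HT0 : T0 <= Tt /\ T0 <= Tc /\ T0 <= Ts /\ T0 <= Tb).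
  { unfold T0. pose proof (Rmin_l (Rmin Tt Tc) (Rmin Ts Tb)). pose proof (Rmin_r (Rmin Tt Tc) (Rmin Ts Tb)).
    pose proof (Rmin_l Tt Tc). pose proof (Rmin_r Tt Tc). pose proof (Rmin_l Ts Tb). pose proof (Rmin_r Ts Tb). lra. }
  clearbody T0. exists T0. split.
  { intros t Ht. destruct (HTs t ltac:(lra)) as [E1 E2].
    apply Rabs_le_between in E1. apply Rabs_le_between in E2. nra. }
  intros T2 delta HT2 Hdelta.
  set (Q := m ^ 2 * exp (2 * m * T2)).
  assert (HQ : 0 < Q) by (apply Rmult_lt_0_compat; [ lra | apply exp_pos ]).
  destruct (bounded_on_interval ys T0 T2 HT2) as (M1 & HM1).
  { intros x; apply (is_derive_continuous _ _ _ (proj1 (Hys x))). }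
  set (M := Rmax M1 (Rpower ((p + 1) / 2 * (1 + Q)) (/ (p - 1)))).
  set (L := p * ppow (p - 1) M).
  assert (HL : 0 <= L) by (unfold L; pose proof (ppow_ge0 (p - 1) M); nra).
  destruct (sqdist_derivative_bound a m p M T2 Hp Ha0 Hm) as (Kg & HKg & Hgr).
  (* The denominator adds up the Lipschitz coefficients of [critical_slope] in [(y, y')], and also
     covers [y' - c y]. *)
  set (del := delta / (1 + L + Q + a + c)).
  assert (Hdel : 0 < del) by (apply Rdiv_lt_0_compat; lra).
  set (X := exp (Kg * (T2 - T0))).
  assert (HX : 0 < X) by apply exp_pos.
  (* When contraction starts, each coordinate differs by at most [2 rho], so the squared distance is
     at most [8 rho^2]; [C] and [X] are the contraction and Gronwall factors. *)
  set (W := X * (C * (8 * rho ^ 2))).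
  assert (HW : 0 < W) by (unfold W; pose proof (pow_lt rho 2 Hrho); repeat apply Rmult_lt_0_compat; lra).
  destruct (exp_eventually_le cc (del ^ 2 / W) Hcc ltac:(apply Rdiv_lt_0_compat; [ apply pow_lt | ]; lra)) as (Tw & HTw).
  (* For [g] above this value, trapping is complete at [t1 + K <= T0 + Rmin Tw 0], leaving enough
     time before [T0] to contract below [del^2 / X]. *)
  set (G1 := exp (c * (tau0 + K - T0 - Rmin Tw 0))).
  exists (Rmax 2 G1). intros g U dU HG Hg HU Hlim y dy.
  pose proof (Rmax_l 2 G1). pose proof (Rmax_r 2 G1).
  set (t1 := tau0 - ln g / c).
  assert (Ht1 : t1 + K <= T0 + Rmin Tw 0).
  { assert (Hln : c * (tau0 + K - T0 - Rmin Tw 0) <= ln g).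
    { rewrite <- (ln_exp (c * (tau0 + K - T0 - Rmin Tw 0))). fold G1. left; apply ln_increasing; [ apply exp_pos | lra ]. }
    apply (Rmult_le_compat_l (/ c)) in Hln; [ | left; apply Rinv_0_lt_compat, Hc ].
    rewrite <- Rmult_assoc, Rinv_l, Rmult_1_l in Hln by lra.
    unfold t1, Rdiv. lra. }
  pose proof (Rmin_l Tw 0). pose proof (Rmin_r Tw 0).
  destruct (Hgap g U dU HU Hlim Hg) as (Hgap1 & Hgap2). fold y dy t1 in Hgap1, Hgap2.
  assert (Hy : emden a m p y dy) by (apply (emden_of_log_radial a m d p c A); assumption).
  assert (Hypos : forall t, 0 < y t).
  { intros t. apply Rmult_lt_0_compat; [ apply Rdiv_lt_0_compat; [ apply exp_pos | exact HA ] | ].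
    apply (regular_pos a m d p c A g U dU); assumption. }
  assert (Hen : forall t, energy m p y dy t <= 0).
  { intros t. left. apply (regular_energy_neg a m d p c A g U dU); assumption. }
  split.
  (* Up to [t1], [U >= g / 2 > 1]. After [t1] the energy loss gives [y >= sqrt eta], and
     [U = A y exp (- c t)] is large because [t <= Tb]. *)
  - assert (HU1 : forall t, t <= T0 -> 1 < U t).
    { intros t Ht. destruct (Rle_dec t t1) as [Hl|Hl]; [ specialize (Hgap2 t Hl); lra | ].
      assert (Hent : energy m p y dy t <= - eta).
      { apply Rle_trans with (2 := Hgap1). apply (energy_antitone a); try assumption; lra. }
      unfold energy in Hent. specialize (HTa1 t ltac:(lra)). set (q := m ^ 2 * exp (2 * m * t)) in *.
      assert (0 <= y t * ppow p (y t) / (p + 1)).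
      { apply Rdiv_le_0_compat; [ | lra ]. apply Rmult_le_pos; [ left; apply Hypos | apply ppow_ge0 ]. }
      pose proof (pow2_ge_0 (dy t)). pose proof (pow2_ge_0 (y t)).
      assert (q * y t ^ 2 <= 1 * y t ^ 2) by (apply Rmult_le_compat_r; lra).
      assert (Hyt : sqrt eta <= y t).
      { rewrite <- (sqrt_pow2 (y t)) by (left; apply Hypos). apply sqrt_le_1_alt. lra. }
      specialize (HTb t ltac:(lra)).
      assert (HUt : U t = A * y t / exp (c * t)).
      { unfold y. pose proof (exp_pos (c * t)). field. lra. }
      pose proof (exp_pos (c * t)). rewrite HUt. apply Rmult_lt_reg_r with (exp (c * t)); [ assumption | ].
      replace (A * y t / exp (c * t) * exp (c * t)) with (A * y t) by (field; lra).
      assert (A * sqrt eta <= A * y t) by (apply Rmult_le_compat_l; lra).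
      assert (0 < A * sqrt eta) by (apply Rmult_lt_0_compat; lra). lra. }
    intros t Ht. apply (log_radial_decreasing_while_gt_1 m d p g T0 t U dU); assumption.
  - assert (Hdist0 : sqdist y dy ys dys T0 <= C * exp (- cc * (T0 - (t1 + K))) * (8 * rho ^ 2)).
    { assert (Hnear : forall x, t1 + K <= x <= T0 -> (Rabs (y x - 1) <= rho /\ Rabs (dy x) <= rho) /\
         (Rabs (ys x - 1) <= rho /\ Rabs (dys x) <= rho)).
      { intros x Hx. split.
        - apply (Htrap y dy t1); try assumption; [ intros; apply Hypos | lra ].
        - destruct (HTs x ltac:(lra)). lra. }
      apply Rle_trans with (C * exp (- cc * (T0 - (t1 + K))) * sqdist y dy ys dys (t1 + K)).
      - apply Hcontr; try assumption; [ lra | ]. intros x Hx. destruct (Hnear x Hx). lra.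
      - apply Rmult_le_compat_l; [ left; apply Rmult_lt_0_compat; [ exact HC | apply exp_pos ] | ].
        destruct (Hnear (t1 + K) ltac:(lra)) as [[N1 N2] [N3 N4]]. unfold sqdist.
        assert (E1 : Rabs (y (t1 + K) - ys (t1 + K)) <= 2 * rho).
        { apply Rabs_le_between in N1. apply Rabs_le_between in N3. apply Rabs_le_between. lra. }
        assert (E2 : Rabs (dy (t1 + K) - dys (t1 + K)) <= 2 * rho).
        { apply Rabs_le_between in N2. apply Rabs_le_between in N4. apply Rabs_le_between. lra. }
        pose proof (pow_maj_Rabs _ _ 2 E1). pose proof (pow_maj_Rabs _ _ 2 E2). lra. }
    assert (Hyb : forall x, T0 <= x <= T2 -> Rabs (y x) <= M).
    { intros x Hx. rewrite Rabs_pos_eq by (left; apply Hypos).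
      apply Rle_trans with (2 := Rmax_r _ _).
      apply (nonpos_energy_bounds m p Q x y dy); [ exact Hp | | apply Hypos | apply Hen ].
      apply Rmult_le_compat_l; [ lra | ]. apply exp_le_of. apply Rmult_le_compat_l; lra. }
    assert (Hysb : forall x, T0 <= x <= T2 -> Rabs (ys x) <= M).
    { intros x Hx. apply Rle_trans with (2 := Rmax_l _ _). auto. }
    destruct (Hgr y dy ys dys Hy Hys) as (dV & HdV & HdV').
    intros t Ht.
    assert (Hdist : sqdist y dy ys dys t <= del ^ 2).
    { apply Rle_trans with (exp (Kg * (t - T0)) * sqdist y dy ys dys T0).
      - apply (gronwall _ dV); [ lra | auto | ]. intros x Hx.
        specialize (HdV' x ltac:(lra) (Hyb x ltac:(lra)) (Hysb x ltac:(lra))).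
        apply Rabs_le_between in HdV'. lra.
      - apply Rle_trans with (X * (C * exp (- cc * (T0 - (t1 + K))) * (8 * rho ^ 2))).
        + assert (0 <= sqdist y dy ys dys T0).
          { unfold sqdist. pose proof (pow2_ge_0 (y T0 - ys T0)). pose proof (pow2_ge_0 (dy T0 - dys T0)). lra. }
          apply Rmult_le_compat; [ left; apply exp_pos | assumption | | exact Hdist0 ].
          apply exp_le_of. apply Rmult_le_compat_l; lra.
        + specialize (HTw (t1 + K - T0) ltac:(lra)).
          replace (- cc * (T0 - (t1 + K))) with (cc * (t1 + K - T0)) by ring.
          apply (Rmult_le_compat_l W) in HTw; [ | lra ].
          replace (W * (del ^ 2 / W)) with (del ^ 2) in HTw by (field; lra).
          unfold W in HTw. lra. }
    unfold sqdist in Hdist.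
    assert (D1 : Rabs (y t - ys t) <= del).
    { apply Rabs_le_of_sq; [ lra | ]. pose proof (pow2_ge_0 (dy t - dys t)). lra. }
    assert (D2 : Rabs (dy t - dys t) <= del).
    { apply Rabs_le_of_sq; [ lra | ]. pose proof (pow2_ge_0 (y t - ys t)). lra. }
    assert (HS : (1 + L + Q + a + c) * del = delta) by (unfold del; field; lra).
    pose proof (ppow_lipschitz p M _ _ Hp (Hyb t Ht) (Hysb t Ht)) as D3. fold L in D3.
    assert (D4 : L * Rabs (y t - ys t) <= L * del) by (apply Rmult_le_compat_l; lra).
    assert (Hq : 0 < m ^ 2 * exp (2 * m * t) <= Q).
    { split; [ apply Rmult_lt_0_compat; [ lra | apply exp_pos ] | ].
      apply Rmult_le_compat_l; [ lra | ]. apply exp_le_of. apply Rmult_le_compat_l; lra. }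
    assert (D5 : Rabs (m ^ 2 * exp (2 * m * t) * (y t - ys t)) <= Q * del).
    { rewrite Rabs_mult, Rabs_pos_eq by lra. apply Rmult_le_compat; [ lra | apply Rabs_pos | lra | lra ]. }
    assert (D6 : Rabs ((a + c) * (dy t - dys t)) <= (a + c) * del).
    { rewrite Rabs_mult, Rabs_pos_eq by lra. apply Rmult_le_compat_l; lra. }
    assert (D7 : Rabs (c * (y t - ys t)) <= c * del).
    { rewrite Rabs_mult, Rabs_pos_eq by lra. apply Rmult_le_compat_l; lra. }
    assert (D8 : 0 <= L * del /\ 0 <= Q * del /\ 0 <= a * del).
    { split; [ | split ]; apply Rmult_le_pos; lra. }
    assert (D9 : Rabs (ppow p (y t) - ppow p (ys t)) <= L * del) by lra.
    apply Rabs_le_between in D1. apply Rabs_le_between in D2. apply Rabs_le_between in D5.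
    apply Rabs_le_between in D6. apply Rabs_le_between in D7. apply Rabs_le_between in D9.
    unfold critical_slope. split; apply Rabs_le_between; lra.
Qed.

(** * Return to the radial variable *)

Lemma critical_iff_zero (g : R -> R) (s k x : R) : 0 < k -> derivable_pt_lim g s (k * x) ->
  (derivable_pt_lim g s 0 <-> x = 0).
Proof.
  intros Hk H. split.
  - intros H0. pose proof (uniqueness_limite _ _ _ _ H H0). nra.
  - intros ->. rewrite Rmult_0_r in H. exact H.
Qed.

Lemma nth_crit_of_zeros (g phi : R -> R) (m : R) (z : nat -> R) (n : nat) :
  0 < m -> (forall s, 0 < s -> (derivable_pt_lim g s 0 <-> phi (ln s / m) = 0)) ->
  (forall k, (1 <= k <= n)%nat -> phi (z k) = 0) ->
  (forall k, (1 <= k < n)%nat -> z k < z (S k)) ->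
  (forall x, x < z n -> phi x = 0 -> exists k, (1 <= k <= n)%nat /\ x = z k) ->
  is_nth_crit g n (exp (m * z n)).
Proof.
  intros Hm Hiff H0 Hinc Hall.
  assert (Hexp : forall s, 0 < s -> s = exp (m * (ln s / m))).
  { intros s Hs. replace (m * (ln s / m)) with (ln s) by (field; lra). symmetry; apply exp_ln, Hs. }
  exists (fun k => exp (m * z k)). split; [ reflexivity | ]. split; [ | split ].
  - intros k Hk. split; [ apply exp_pos | ]. apply Hiff; [ apply exp_pos | ].
    rewrite ln_exp. replace (m * z k / m) with (z k) by (field; lra). auto.
  - intros k Hk. apply exp_increasing, Rmult_lt_compat_l; auto.
  - intros s Hs Hcrit. destruct (Hall (ln s / m)) as (k & Hk & Heq).
    + apply Rmult_lt_reg_l with m; [ exact Hm | ]. apply exp_lt_inv. rewrite <- Hexp; lra.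
    + apply Hiff; [ lra | exact Hcrit ].
    + exists k. split; [ exact Hk | ]. rewrite <- Heq. apply Hexp; lra.
Qed.

Lemma log_radial_of_radial (N : nat) (p m g : R) (u : R -> R) : 0 < m -> is_radial_sol N p g u ->
  exists U dU, log_radial m (INR N) p U dU /\ is_lim U m_infty g /\
    forall s, 0 < s -> derivable_pt_lim u s (/ (m * s) * dU (ln s / m)).
Proof.
  intros Hm (Hu0 & Hdu0 & du & ddu & Hu).
  exists (fun t => u (exp (m * t))), (fun t => m * exp (m * t) * du (exp (m * t))).
  split; [ | split ].
  - intros t. pose proof (exp_pos (m * t)) as He. destruct (Hu _ He) as (H1 & H2 & H3).
    apply is_derive_Reals in H1. apply is_derive_Reals in H2. split.
    + auto_derive; [ eexists; eassumption | ].
      rewrite (is_derive_unique (fun x : R => u x) _ _ H1). ring.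
    + auto_derive; [ eexists; eassumption | ].
      rewrite (is_derive_unique (fun x : R => du x) _ _ H2).
      replace (2 * m * t) with (m * t + m * t) by ring. rewrite exp_plus.
      replace (fN p (u (exp (m * t)))) with
        (- ddu (exp (m * t)) - (INR N - 1) / exp (m * t) * du (exp (m * t))) by lra.
      field. lra.
  - rewrite <- Hu0. apply is_lim_comp_continuous; [ apply is_lim_exp_scal, Hm | ].
    apply is_derive_Reals in Hdu0. apply (is_derive_continuous _ _ _ Hdu0).
  - intros s Hs. destruct (Hu s Hs) as (H1 & _).
    replace (m * (ln s / m)) with (ln s) by (field; lra). rewrite exp_ln by exact Hs.
    replace (/ (m * s) * (m * s * du s)) with (du s) by (field; lra). exact H1.
Qed.

Lemma ustar_is_derive (N : nat) (p : R) (y dy : R -> R) (s : R) :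
  0 < s -> 0 < mconst N p -> (forall t, is_derive y t (dy t)) ->
  derivable_pt_lim (ustar N p y) s
    (Aconst N p * Rpower s (- theta p) / (mconst N p * s)
      * (dy (ln s / mconst N p) - mconst N p * theta p * y (ln s / mconst N p))).
Proof.
  intros Hs Hm Hy. apply is_derive_Reals. unfold ustar, Rpower. auto_derive.
  - repeat split; try assumption. eexists; apply Hy.
  - rewrite (is_derive_unique (fun x : R => y x) _ _ (Hy _)). unfold Rdiv. field. lra.
Qed.

(** Supercriticality is exactly [N - 2 - 2 theta > 0], hence the positive damping; the identities
    follow from [theta (p - 1) = 2] and the definitions of [m] and [A]. *)
Lemma emden_constants (N : nat) (p : R) : (3 <= N)%nat -> pS N < p ->
  let m := mconst N p in let A := Aconst N p in let c := m * theta p in let a := alpha N p in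
  1 < p /\ 0 < a /\ 0 < m /\ 3 <= INR N /\ 0 < c /\ 0 < A /\
  a = m * (INR N - 2) - 2 * c /\ c ^ 2 + a * c = 1 /\ c * (p - 1) = 2 * m /\ m ^ 2 * Rpower A (p - 1) = 1.
Proof.
  intros HN Hp m A c a. apply le_INR in HN. simpl in HN. replace (1 + 1 + 1) with 3 in HN by ring.
  set (d := INR N) in *. unfold pS in Hp. fold d in Hp.
  assert (Hp' : d + 2 < p * (d - 2)) by (apply Rlt_div_l in Hp; lra).
  assert (H1 : 1 < p) by nra.
  assert (Ht : theta p * (p - 1) = 2) by (unfold theta; field; lra).
  assert (Ht0 : 0 < theta p) by (apply Rdiv_lt_0_compat; lra).
  assert (Ht2 : 0 < d - 2 - 2 * theta p) by nra.
  set (th := theta p) in *.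
  assert (HB : 0 < th * (d - 2 - th)) by nra.
  assert (Hm : 0 < m) by (apply Rinv_0_lt_compat, sqrt_lt_R0, HB).
  assert (Hm2 : m ^ 2 * (th * (d - 2 - th)) = 1).
  { unfold m, mconst. fold th d. rewrite pow_inv, pow2_sqrt by lra. apply Rinv_l. lra. }
  assert (HA : Rpower A (p - 1) = th * (d - 2 - th)).
  { unfold A, Aconst. rewrite Rpower_mult. fold th d.
    replace (1 / (p - 1) * (p - 1)) with 1 by (field; lra). apply Rpower_1, HB. }
  assert (Haa : a = m * (d - 2 - 2 * th)) by reflexivity.
  repeat split; try assumption.
  - rewrite Haa. nra.
  - unfold c. nra.
  - apply exp_pos.
  - rewrite Haa. unfold c. ring.
  - rewrite Haa. unfold c. rewrite <- Hm2. ring.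
  - unfold c. rewrite Rmult_assoc, Ht. ring.
  - rewrite HA. exact Hm2.
Qed.

Theorem theorem5p2 :
  forall (N : nat) (p : R) (n : nat),
    (3 <= N)%nat -> pS N < p -> (1 <= n)%nat ->
    forall ystar : R -> R, is_ystar N p ystar ->
    forall sstar : R, is_nth_crit (ustar N p ystar) n sstar ->
    forall (u : R -> R -> R) (sigma : R -> R),
      (forall gamma : R, 1 < gamma ->
          is_radial_sol N p gamma (u gamma) /\ is_nth_crit (u gamma) n (sigma gamma)) ->
      forall eps : R, 0 < eps ->
        exists G : R, forall gamma : R, G < gamma ->
          Rabs ((sigma gamma) ^ 2 - sstar ^ 2) < eps.
Proof.
  intros N p n HN HpS Hn ys ((dys & ddys & Hode) & Hlims) sstar (cs & Hcn & Hc1 & Hc2 & Hc3) u sigma Hu eps Heps.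
  destruct (emden_constants N p HN HpS) as (Hp & Ha0 & Hm & Hd & Hc & HA & Ha & Hca & Hcp & HmA).
  set (m := mconst N p) in *. set (A := Aconst N p) in *. set (c := m * theta p) in *. set (a := alpha N p) in *.
  assert (Hys : emden a m p ys dys).
  { intros t. destruct (Hode t) as (H1 & H2 & H3). split; [ apply is_derive_Reals, H1 | ].
    apply is_derive_Reals. replace (- a * dys t + _ - _ + _) with (ddys t) by (fold a m in H3; lra). exact H2. }
  destruct (regular_solutions_converge a m (INR N) p c A ys dys Hp Ha0 Hm Hd Hc HA Ha Hca Hcp HmA Hys Hlims)
    as (T0 & Hneg & Hconv).
  set (phi := fun t => dys t - c * ys t) in *.
  assert (Hphi : forall x, is_derive phi x (critical_slope a c m p ys dys x)).
  { intros x. destruct (Hys x) as [H1 H2]. apply @is_derive_minus; [ exact H2 | apply is_derive_scal, H1 ]. }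
  assert (Hcrit : forall s, 0 < s -> (derivable_pt_lim (ustar N p ys) s 0 <-> phi (ln s / m) = 0)).
  { intros s Hs. apply critical_iff_zero with (k := A * Rpower s (- theta p) / (m * s)).
    - apply Rdiv_lt_0_compat; apply Rmult_lt_0_compat; try assumption. apply exp_pos.
    - apply (ustar_is_derive N p ys dys s Hs Hm). intros; apply Hys. }
  assert (Hexpln : forall k, (1 <= k <= n)%nat -> cs k = exp (m * (ln (cs k) / m))).
  { intros k Hk. replace (m * (ln (cs k) / m)) with (ln (cs k)) by (field; lra).
    symmetry; apply exp_ln, Hc1, Hk. }
  (* Index [0] holds the left end of the window, as [zeros_persist] expects; the critical points
     start at index [1]. *)
  set (t := fun k => match k with O => T0 | S _ => ln (cs k) / m end).
  assert (Htk : forall k, (1 <= k <= n)%nat -> t k = ln (cs k) / m) by (intros [|k] Hk; [ lia | reflexivity ]).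
  assert (Hz : forall k, (1 <= k <= n)%nat -> phi (t k) = 0).
  { intros k Hk. rewrite Htk by exact Hk. apply Hcrit; apply Hc1, Hk. }
  destruct (zeros_persist phi (critical_slope a c m p ys dys) t n) as (r & Hr & Hpersist).
  - exact Hphi.
  - intros x. apply critical_slope_continuous; assumption.
  - specialize (Hneg T0 ltac:(lra)). change (phi T0 <> 0). unfold phi. lra.
  - intros [|k] Hk.
    + apply Rnot_le_lt; intros Hle. specialize (Hneg _ Hle). specialize (Hz 1%nat ltac:(lia)).
      unfold phi in Hz. lra.
    + rewrite 2!Htk by lia. apply Rmult_lt_compat_r; [ apply Rinv_0_lt_compat, Hm | ].
      apply ln_increasing; [ apply Hc1; lia | apply Hc2; lia ].
  - intros k Hk. split; [ apply Hz, Hk | ].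
    pose proof (emden_critical_nondegenerate a m p c ys dys (t k) Hp Ha0 Hm Hc Hca Hcp Hys Hlims) as Hnd.
    specialize (Hz k Hk). unfold phi in Hz. specialize (Hnd ltac:(lra)). unfold critical_slope. lra.
  - intros x Hx Hx0. destruct (Req_dec x (t n)) as [->|Hne]; [ exists n; split; [ lia | reflexivity ] | ].
    destruct (Hc3 (exp (m * x))) as (k & Hk & Hxk).
    + split; [ apply exp_pos | ]. rewrite <- Hcn, Hexpln by lia. apply exp_increasing, Rmult_lt_compat_l; [ exact Hm | ].
      rewrite <- Htk by lia. lra.
    + apply Hcrit; [ apply exp_pos | ]. rewrite ln_exp. replace (m * x / m) with x by (field; lra). exact Hx0.
    + exists k. split; [ exact Hk | ]. rewrite Htk, <- Hxk, ln_exp by exact Hk. field; lra.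
  (* [lambda = s^2 = exp (2 m t)], so continuity here turns closeness of the zeros in [t] into
     closeness of the eigenvalues. *)
  - assert (Hcont : continuity_pt (fun x => exp (2 * m * x)) (t n)).
    { apply continuity_pt_filterlim, (ex_derive_continuous (fun x => exp (2 * m * x))). auto_derive. exact I. }
    destruct (Hcont eps Heps) as (e & He & Hcont').
    set (e' := Rmin r e).
    assert (He' : 0 < e' /\ e' <= r /\ e' <= e).
    { unfold e'. split; [ apply Rmin_pos; lra | ]. split; [ apply Rmin_l | apply Rmin_r ]. }
    clearbody e'.
    destruct (Hpersist e' ltac:(lra)) as (delta & Hdelta & Hpers).
    assert (H0n : T0 <= t n).
    { apply Rnot_lt_le; intros Hlt. specialize (Hneg (t n) ltac:(lra)). specialize (Hz n ltac:(lia)).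
      unfold phi in Hz. lra. }
    destruct (Hconv (t n + e') delta ltac:(lra) Hdelta) as (G & HG).
    exists (Rmax 1 G). intros gam Hgam. pose proof (Rmax_l 1 G). pose proof (Rmax_r 1 G).
    destruct (Hu gam ltac:(lra)) as (Hrad & Hnth).
    destruct (log_radial_of_radial N p m gam (u gam) Hm Hrad) as (U & dU & HU & Hlim & Hder).
    destruct (HG gam U dU ltac:(lra) ltac:(lra) HU Hlim) as (HdU & Hclose).
    set (y := fun t => exp (c * t) / A * U t) in *. set (dy := fun t => exp (c * t) / A * (c * U t + dU t)) in *.
    assert (Hy : emden a m p y dy) by (apply (emden_of_log_radial a m (INR N) p c A); assumption).
    set (psi := fun t => dy t - c * y t) in *.
    assert (Hpsi : forall x, psi x = exp (c * x) / A * dU x) by (intros x; unfold psi, dy, y; ring).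
    assert (Hk : forall x, 0 < exp (c * x) / A) by (intros x; apply Rdiv_lt_0_compat; [ apply exp_pos | exact HA ]).
    destruct (Hpers psi (critical_slope a c m p y dy)) as (z & Z1 & Z2 & Z3).
    { intros x. destruct (Hy x) as [H1 H2]. apply @is_derive_minus; [ exact H2 | apply is_derive_scal, H1 ]. }
    { exact Hclose. }
    destruct (Z1 n ltac:(lia)) as (Zn1 & Zn2 & Zn3).
    assert (Hsig : sigma gam = exp (m * z n)).
    { apply (nth_crit_unique (u gam) n); [ exact Hn | exact Hnth | ].
      apply (nth_crit_of_zeros (u gam) psi m); [ exact Hm | | intros; apply Z1; assumption | exact Z2 | ].
      - intros s Hs. specialize (Hk (ln s / m)).
        apply iff_trans with (dU (ln s / m) = 0).
        + apply critical_iff_zero with (k := / (m * s)); [ apply Rinv_0_lt_compat; nra | apply Hder, Hs ].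
        + rewrite Hpsi. split; [ intros ->; ring | intros H1; nra ].
      (* A zero left of [T0] is impossible since [U' < 0] there; this fixes the index of [z n] at
         exactly [n]. *)
      - intros x Hx Hx0. apply Z3; [ | exact Hx0 ]. apply Rabs_lt_between in Zn3. split; [ | lra ].
        apply Rnot_lt_le; intros Hlt. specialize (HdU x ltac:(simpl in Hlt; lra)).
        rewrite Hpsi in Hx0. specialize (Hk x). nra. }
    assert (Hsq : forall x, exp (m * x) ^ 2 = exp (2 * m * x)).
    { intros x. replace (2 * m * x) with (m * x + m * x) by ring. rewrite exp_plus. ring. }
    rewrite Hsig, <- Hcn, Hexpln, <- Htk, 2!Hsq by lia.
    destruct (Req_dec (z n) (t n)) as [->|Hne]; [ rewrite Rminus_diag, Rabs_R0; exact Heps | ].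
    apply (Hcont' (z n)). split; [ split; [ exact I | congruence ] | ].
    simpl. unfold Rdist. lra.
Qed.
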